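(* Let $A\in\mathcal{M}_d(\mathbb{C})$ be self-adjoint, let $\mathcal{X},\mathcal{Y}\subset\mathbb{C}^d$ be subspaces of dimension $k$, and let $\delta>0$ be such that $(A,\mathcal{X},\mathcal{Y},\delta)$ satisfies the DKN separation property. Let $X,Y\in\mathcal{M}_{d,k}(\mathbb{C})$ have columns forming orthonormal bases of $\mathcal{X}$ and $\mathcal{Y}$, respectively, and let $R_Y=AY-Y\rho(Y)$. Then, for every unitarily invariant norm $\|\cdot\|$, $$\|\lambda(\rho(X))-\lambda(\rho(Y))\|\le\frac{\|P_{\mathcal{X}+\mathcal{Y}}R_Y\|^2}{\delta}.$$
   Context: $\mathcal{M}_{d,k}(\mathbb{C})$ is the space of complex $d\times k$ matrices and $\mathcal{M}_d(\mathbb{C})=\mathcal{M}_{d,d}(\mathbb{C})$. $\rho(X)=X^*AX$, $\rho(Y)=Y^*AY$. $P_{\mathcal{Z}}$ is the orthogonal projection onto $\mathcal{Z}$. For a self-adjoint matrix $C$, $\lambda(C)=(\lambda_i(C))_i$ is the vector of eigenvalues counted with multiplicity in non-increasing order. DKN (Davis-Kahan-Nakatsukasa) separation property: let $A\in\mathcal{M}_d(\mathbb{C})$ be self-adjoint, let $\mathcal{X},\mathcal{Y}\subset\mathbb{C}^d$ be subspaces with $\dim\mathcal{X}=\dim\mathcal{Y}=k$ and $\mathcal{X}$ $A$-invariant, let $X_\perp\in\mathcal{M}_{d,d-k}(\mathbb{C})$ have columns forming an orthonormal basis of $\mathcal{X}^\perp$ and let $Y\in\mathcal{M}_{d,k}(\mathbb{C})$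 have columns forming an orthonormal basis of $\mathcal{Y}$. Given $\delta>0$, $(A,\mathcal{X},\mathcal{Y},\delta)$ satisfies the DKN separation property if there exist real $a\le b$ such that (1) $\lambda_i(X_\perp^*AX_\perp)\in[a,b]$ for $1\le i\le d-k$, and (2) $\lambda_i(Y^*AY)\in(-\infty,a-\delta]\cup[b+\delta,\infty)$ for $1\le i\le k$. (In particular the $A$-invariance of $\mathcal{X}$ is part of the property.) A norm on $\mathcal{M}_d(\mathbb{C})$ is unitarily invariant if $\|UBV\|=\|B\|$ for all $B\in\mathcal{M}_d(\mathbb{C})$ and unitary $U,V$. It is applied to $d\times k$ matrices by padding with zeros to size $d\times d$, and to a vector $x\in\mathbb{R}^k$ as the norm of the diagonal matrix with main diagonal $x$ (padded with zeros).
   Formalization: The unitarily invariant norm is additionally assumed to satisfy ‖diag(1,0,…,0)‖ ≥ 1; the inequality is not homogeneous in the norm and fails, for instance, for small multiples of the spectral norm. *)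

(* Defs.v *)
From HB Require Import structures.
From mathcomp Require Import all_boot all_order all_algebra.
From mathcomp Require Import spectral sesquilinear reals complex.

Set Implicit Arguments.
Unset Strict Implicit.
Unset Printing Implicit Defensive.

Import Order.TTheory GRing.Theory Num.Theory.
Local Open Scope ring_scope.
Local Open Scope sesquilinear_scope.
Local Open Scope complex_scope.

Section Definitions.
Variable R : realType.
Local Notation C := R[i].

(* Self-adjointness of M is [M \is hermsymmx].  [spectral_diag] lists the
   eigenvalues with multiplicity; they are real when M is self-adjoint (so that
   taking real parts loses nothing, see [char_poly_lambda]). *)
Definition lambda n (M : 'M[C]_n) : 'rV[R]_n :=
  \row_i nth 0 (sort >=%R [seq complex.Re (spectral_diag M 0 j) | j : 'I_n]) i.

Definition rho d k (A : 'M[C]_d) (X : 'M[C]_(d, k)) : 'M[C]_k :=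
  X ^t* *m A *m X.

Definition has_orthonormal_basis d n (Z : {vspace 'cV[C]_d})
    (M : 'M[C]_(d, n)) : Prop :=
  M ^t* *m M = 1%:M /\ basis_of Z [seq col j M | j : 'I_n].

Definition invariant_subspace d (A : 'M[C]_d) (Z : {vspace 'cV[C]_d}) : Prop :=
  forall v, v \in Z -> A *m v \in Z.

Definition basis_rows d (Z : {vspace 'cV[C]_d}) : 'M[C]_(\dim Z, d) :=
  \matrix_i (tnth (vbasis Z) i)^T.

Definition ortho_vs d (Z : {vspace 'cV[C]_d}) : {vspace 'cV[C]_d} :=
  lker (linfun (mulmx (map_mx Num.conj (basis_rows Z)))).

(* [proj_ortho] acts on row vectors by right multiplication, whence the
   transposition; see [orthprojP]. *)
Definition orthproj d (Z : {vspace 'cV[C]_d}) : 'M[C]_d :=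
  (proj_ortho (basis_rows Z))^T.

(* The bases are quantified existentially; another choice of orthonormal bases
   changes the two compressions by unitary conjugation only. *)
Definition DKN d k (A : 'M[C]_d) (XX YY : {vspace 'cV[C]_d}) (delta : R) : Prop :=
  [/\ A \is hermsymmx, \dim XX = k, \dim YY = k, invariant_subspace A XX &
   exists (Xperp : 'M[C]_(d, d - k)) (Y : 'M[C]_(d, k)),
   [/\ has_orthonormal_basis (ortho_vs XX) Xperp,
       has_orthonormal_basis YY Y &
     exists a b : R,
     [/\ a <= b,
         forall i, a <= lambda (rho A Xperp) 0 i <= b &
         forall i, lambda (rho A Y) 0 i <= a - delta \/
                   b + delta <= lambda (rho A Y) 0 i]]].

Record unitarily_invariant_norm d (N : 'M[C]_d -> R) : Prop :=
  UnitarilyInvariantNorm {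
    uin_ge0 : forall B, 0 <= N B;
    uin_eq0 : forall B, N B = 0 -> B = 0;
    uinZ : forall (c : C) B, N (c *: B) = ComplexField.Normc.normc c * N B;
    uin_triangle : forall B1 B2, N (B1 + B2) <= N B1 + N B2;
    uin_unitary : forall U B V, U \is unitarymx -> V \is unitarymx ->
      N (U *m B *m V) = N B
  }.

(* The usual normalization N(diag(1, 0, ..., 0)) = 1 of unitarily invariant
   norms, relaxed to an inequality; the E_ii all have the same norm by unitary
   invariance.  For such norms this amounts to submultiplicativity.  It is needed
   for a bound that is not homogeneous in N, such as one of N(B1) by N(B2)^2. *)
Definition normalized d (N : 'M[C]_d -> R) : Prop :=
  forall i, 1 <= N (delta_mx i i).

(* For m, n <= d this puts B in the upper left corner and zeros elsewhere,
   as [pid_mx] is the (rectangular) matrix of Kronecker deltas. *)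
Definition pad d m n (B : 'M[C]_(m, n)) : 'M[C]_d :=
  (pid_mx m : 'M_(d, m)) *m B *m (pid_mx n : 'M_(n, d)).

Definition pad_vec d k (x : 'rV[R]_k) : 'M[C]_d :=
  pad d (diag_mx (map_mx (fun r : R => r%:C) x)).

Lemma basis_rowsP d (Z : {vspace 'cV[C]_d}) (v : 'cV[C]_d) :
  (v^T <= basis_rows Z)%MS = (v \in Z).
Proof.
apply/submxP/idP => [[D vE]|vZ].
  have -> : v = \sum_i D 0 i *: tnth (vbasis Z) i.
    rewrite -[v]trmxK vE mulmx_sum_row linear_sum /=.
    by apply: eq_bigr => i _; rewrite linearZ /= rowK trmxK.
  by apply: memv_suml => i _; rewrite memvZ// vbasis_mem// mem_tnth.
exists (\row_i coord (vbasis Z) i v).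
rewrite mulmx_sum_row {1}(coord_vbasis vZ) linear_sum /=.
by apply: eq_bigr => i _; rewrite linearZ /= rowK mxE (tnth_nth 0).
Qed.

Lemma ortho_vsP d (Z : {vspace 'cV[C]_d}) (v : 'cV[C]_d) :
  v \in ortho_vs Z <-> forall u, u \in Z -> u ^t* *m v = 0.
Proof.
rewrite memv_ker lfunE /=; split=> [/eqP Bv0 u|uv0].
  rewrite -basis_rowsP => /submxP[D uE].
  by rewrite uE map_mxM /= -mulmxA Bv0 mulmx0.
apply/eqP/row_matrixP => i; rewrite row0 row_mul -map_row rowK.
by rewrite uv0// vbasis_mem// mem_tnth.
Qed.

Lemma orthprojP d (Z : {vspace 'cV[C]_d}) (v : 'cV[C]_d) :
  orthproj Z *m v \in Z /\ v - orthproj Z *m v \in ortho_vs Z.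
Proof.
have PE : orthproj Z *m v = (v^T *m proj_ortho (basis_rows Z))^T.
  by rewrite trmx_mul trmxK.
split; first by rewrite PE -basis_rowsP trmxK proj_ortho_sub.
rewrite PE; apply/ortho_vsP => u; rewrite -basis_rowsP => uB.
have := proj_ortho_compl_sub (basis_rows Z) v^T.
set W := v^T - _ => WB.
have -> : v - (v^T *m proj_ortho (basis_rows Z))^T = W^T.
  by rewrite /W linearB /= trmxK.
have /orthomx1P WB0 := WB.
have /submxP[D uE] := uB.
rewrite uE map_mxM /= -mulmxA -[X in _ *m X]trmxK trmx_mul trmxK map_trmx.
by rewrite WB0 trmx0 mulmx0.
Qed.

Lemma lambda_perm n (M : 'M[C]_n) :
  perm_eq [seq lambda M 0 i | i : 'I_n]
          [seq complex.Re (spectral_diag M 0 j) | j : 'I_n].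
Proof.
set s := [seq complex.Re _ | j : 'I_n].
have ss : size (sort >=%R s) = n by rewrite size_sort size_map size_enum_ord.
suff -> : [seq lambda M 0 i | i : 'I_n] = sort >=%R s by rewrite perm_sort.
apply: (@eq_from_nth _ 0); first by rewrite ss size_map size_enum_ord.
move=> i; rewrite size_map size_enum_ord => ltin.
rewrite (nth_map (Ordinal ltin)) ?size_enum_ord// mxE.
by rewrite nth_enum_ord.
Qed.

Lemma lambda_nonincreasing n (M : 'M[C]_n) (i j : 'I_n) :
  (i <= j)%N -> lambda M 0 j <= lambda M 0 i.
Proof.
move=> leij; rewrite !mxE.
have ge_total : total (>=%R : rel R) by move=> x y; exact: le_total.
have ge_trans : transitive (>=%R : rel R) by move=> y x z /[swap]; exact: le_trans.
have ge_refl : reflexive (>=%R : rel R) by move=> x; exact: lexx.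
apply: (sorted_leq_nth ge_trans ge_refl 0 (sort_sorted ge_total _)) => //;
  by rewrite inE /= size_sort size_map size_enum_ord.
Qed.

Lemma char_poly_lambda n (M : 'M[C]_n) : M \is hermsymmx ->
  char_poly M = \prod_(i < n) ('X - ((lambda M 0 i)%:C)%:P).
Proof.
move=> Mh.
have /hermitian_normalmx/orthomx_spectralP ME := Mh.
have char_diag : char_poly M = \prod_(i < n) ('X - (spectral_diag M 0 i)%:P).
  set P := spectralmx M in ME *; set D := diag_mx _ in ME.
  have Pu : P \in unitmx by exact: spectral_unit.
  have <- : char_poly D = \prod_(i < n) ('X - (spectral_diag M 0 i)%:P).
    rewrite char_poly_trig ?diag_mx_is_trig//.
    by apply: eq_bigr => i _; rewrite mxE eqxx mulr1n.
  have QP : map_mx polyC (invmx P) *m map_mx polyC P = 1%:M.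
    by rewrite -map_mxM mulVmx// map_mx1.
  have ME' : char_poly_mx M =
      map_mx polyC (invmx P) *m char_poly_mx D *m map_mx polyC P.
    rewrite /char_poly_mx mulmxBr mulmxBl -!map_mxM -ME.
    by rewrite mul_mx_scalar -scalemxAl QP scalemx1.
  by rewrite /char_poly ME' !det_mulmx mulrAC -det_mulmx QP det1 mul1r.
rewrite char_diag.
transitivity (\prod_(x <- [seq complex.Re (spectral_diag M 0 j) | j : 'I_n])
    ('X - (x%:C)%:P : {poly C})).
  rewrite big_map big_enum /=; apply: eq_bigr => i _; congr ('X - _%:P).
  have /mxOverP/(_ 0 i) := hermitian_spectral_diag_real Mh.
  by move=> /complex_realP[x ->].
by rewrite -(perm_big _ (lambda_perm M)) big_map big_enum.
Qed.

End Definitions.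

(* Main.v *)
Require Import Defs.
From mathcomp Require Import all_boot all_order all_algebra.
From mathcomp Require Import spectral sesquilinear reals complex.
From mathcomp Require Import fingroup perm ring lra.

(* Let [H = rho(Y)], let [P] project onto [XX + YY] and let [R' = P *m R_Y].  The
   cosines of the principal angles between [XX] and [YY] are the singular values
   of [X^t* *m Y]; let [c] be the least of them and [s] the corresponding sine.
   Testing the Sylvester equation for [Xp^t* *m R_Y] at the largest angle gives
   [delta * s <= c * |R'|] (operator norm), so [X^t* *m Y] is invertible, and by
   its polar decomposition the basis [X] may be replaced by one, [X'], for which
   [C = X'^t* *m Y] is positive definite, [c <= C <= 1].  Invariance of [XX] then
   yields the Lyapunov equation
     C G + G C = (X' - Y C)^* R' + R'^* (X' - Y C),  G = rho(X') - H,
   where [X' - Y C] has operator norm at most [s], and [C >= c] implies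
   [2 c N(G) <= N(C G + G C)], whence [N(G) <= s / c * N(R') <= N(R')^2 / delta].
   Finally the Lidskii-Mirsky theorem bounds the differences of the ordered
   eigenvalues of [rho(X')] and [H] by [N(G)]. *)

Set Implicit Arguments.
Unset Strict Implicit.
Unset Printing Implicit Defensive.

Import Order.TTheory GRing.Theory Num.Theory.
Local Open Scope ring_scope.
Local Open Scope sesquilinear_scope.
Local Open Scope complex_scope.

(** * Euclidean norms and spectral decomposition *)

Section Euclidean.
Variable R : realType.
Local Notation C := R[i].

Lemma conj_real (x : R) : Num.conj (x%:C) = x%:C.
Proof. by apply/CrealP/complex_realP; exists x. Qed.

Lemma trmxCM m n p (A : 'M[C]_(m, n)) (B : 'M[C]_(n, p)) :
  (A *m B)^t* = B^t* *m A^t*.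
Proof. by rewrite trmx_mul map_mxM. Qed.

Lemma trmxCD m n (A B : 'M[C]_(m, n)) : (A + B)^t* = A^t* + B^t*.
Proof. by rewrite linearD /= map_mxD. Qed.

Lemma trmxCB m n (A B : 'M[C]_(m, n)) : (A - B)^t* = A^t* - B^t*.
Proof. by rewrite linearB /= map_mxB. Qed.

Lemma trmxCZ m n (a : C) (A : 'M[C]_(m, n)) : (a *: A)^t* = Num.conj a *: A^t*.
Proof. by rewrite linearZ /= map_mxZ. Qed.

Lemma trmxC_scalar n (a : C) : (a%:M : 'M[C]_n)^t* = (Num.conj a)%:M.
Proof. by rewrite tr_scalar_mx map_scalar_mx. Qed.

Lemma hermP n (A : 'M[C]_n) : A \is hermsymmx <-> A^t* = A.
Proof.
split=> [/is_hermitianmxP|] hA; first by rewrite [in RHS]hA expr0 scale1r.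
by apply/is_hermitianmxP; rewrite expr0 scale1r.
Qed.

Definition rdiag n (x : 'rV[R]_n) : 'M[C]_n :=
  diag_mx (map_mx (fun r : R => r%:C) x).

Lemma rdiagE n (x : 'rV[R]_n) i j :
  rdiag x i j = if i == j then (x 0 i)%:C else 0.
Proof. by rewrite !mxE; case: eqP => [->|]. Qed.

Lemma trmxC_rdiag n (x : 'rV[R]_n) : (rdiag x)^t* = rdiag x.
Proof.
apply/matrixP=> i j; rewrite !mxE eq_sym; case: eqP => [->|_].
  by rewrite !mulr1n conj_real.
by rewrite rmorph0.
Qed.

Lemma rdiagM n (x y : 'rV[R]_n) :
  rdiag x *m rdiag y = rdiag (\row_i (x 0 i * y 0 i)).
Proof.
rewrite mulmx_diag; congr diag_mx; apply/rowP=> i; by rewrite !mxE rmorphM.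
Qed.

Lemma rdiagB n (x y : 'rV[R]_n) : rdiag (x - y) = rdiag x - rdiag y.
Proof. by rewrite /rdiag -linearB /= -map_mxB. Qed.

Lemma rdiagD n (x y : 'rV[R]_n) : rdiag (x + y) = rdiag x + rdiag y.
Proof. by rewrite /rdiag -linearD /= -map_mxD. Qed.

Lemma rdiagZ n (a : R) (x : 'rV[R]_n) : rdiag (a *: x) = a%:C *: rdiag x.
Proof.
apply/matrixP=> i j; rewrite [RHS]mxE !rdiagE mxE rmorphM.
by case: eqP; rewrite ?mulr0.
Qed.

Lemma rdiag_const n (a : R) : rdiag (const_mx a : 'rV[R]_n) = (a%:C)%:M.
Proof. by rewrite /rdiag map_const_mx diag_const_mx. Qed.

(** The product is a complex number with zero imaginary part ([sqnE]), so [Re] loses nothing. Norm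
    estimates stay squared to avoid roots. *)
Definition sqn n (v : 'cV[C]_n) : R := complex.Re ((v^t* *m v) 0 0).

Definition rdot n (u v : 'cV[C]_n) : R := complex.Re ((u^t* *m v) 0 0).

Lemma sqn_sum n (v : 'cV[C]_n) : (v^t* *m v) 0 0 = \sum_i `|v i 0| ^+ 2.
Proof. by rewrite mxE; apply: eq_bigr => i _; rewrite !mxE normCKC. Qed.

Lemma sqnE n (v : 'cV[C]_n) : (v^t* *m v) 0 0 = (sqn v)%:C.
Proof.
rewrite /sqn RRe_real// sqn_sum ger0_real// sumr_ge0// => i _.
by rewrite exprn_ge0.
Qed.

Lemma sqn_coef n (v : 'cV[C]_n) :
  sqn v = \sum_i ((complex.Re (v i 0)) ^+ 2 + (complex.Im (v i 0)) ^+ 2).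
Proof.
apply: complexI; rewrite -sqnE sqn_sum rmorph_sum /=.
by apply: eq_bigr => i _; rewrite add_Re2_Im2.
Qed.

Lemma sqn_ge0 n (v : 'cV[C]_n) : 0 <= sqn v.
Proof. by rewrite sqn_coef sumr_ge0// => i _; rewrite addr_ge0 ?sqr_ge0. Qed.

Lemma sqn_eq0 n (v : 'cV[C]_n) : sqn v = 0 -> v = 0.
Proof.
move=> v0; have := sqnE v; rewrite v0 sqn_sum => /eqP.
rewrite psumr_eq0 => [/allP h|i _]; last by rewrite exprn_ge0.
apply/matrixP=> i j; rewrite ord1 mxE.
by have := h i (mem_index_enum _); rewrite /= sqrf_eq0 normr_eq0 => /eqP.
Qed.

Lemma sqn0 n : sqn (0 : 'cV[C]_n) = 0.
Proof. by rewrite /sqn mulmx0 mxE. Qed.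

Lemma sqn_gt0 n (v : 'cV[C]_n) : v != 0 -> 0 < sqn v.
Proof.
move=> v0; rewrite lt_neqAle sqn_ge0 andbT eq_sym.
by apply: contraNneq v0 => /sqn_eq0/eqP.
Qed.

Lemma rdotE n (v : 'cV[C]_n) : rdot v v = sqn v. Proof. by []. Qed.

Lemma rdotC n (u v : 'cV[C]_n) : rdot u v = rdot v u.
Proof.
rewrite /rdot !mxE !raddf_sum /=; apply: eq_bigr => i _; rewrite !mxE.
by case: (u i 0) (v i 0) => [a b] [c d] /=; ring.
Qed.

Lemma rdotDr n (u v w : 'cV[C]_n) : rdot u (v + w) = rdot u v + rdot u w.
Proof. by rewrite /rdot mulmxDr mxE raddfD. Qed.

Lemma rdotZr n (u v : 'cV[C]_n) (a : R) : rdot u (a%:C *: v) = a * rdot u v.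
Proof.
rewrite /rdot -scalemxAr mxE; set z := (_ *m _) 0 0; case: z => x y /=.
by rewrite mul0r subr0.
Qed.

Lemma rdotDl n (u v w : 'cV[C]_n) : rdot (v + w) u = rdot v u + rdot w u.
Proof. by rewrite rdotC rdotDr !(rdotC u). Qed.

Lemma rdotZl n (u v : 'cV[C]_n) (a : R) : rdot (a%:C *: v) u = a * rdot v u.
Proof. by rewrite rdotC rdotZr rdotC. Qed.

Lemma rdot_adj m n (M : 'M[C]_(m, n)) u v : rdot u (M *m v) = rdot (M^t* *m u) v.
Proof. by rewrite /rdot trmxCM trmxCK mulmxA. Qed.

Lemma sqnD n (u v : 'cV[C]_n) : sqn (u + v) = sqn u + 2 * rdot u v + sqn v.
Proof.
by rewrite -!rdotE rdotDr !rdotDl (rdotC v u); ring.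
Qed.

Lemma sqnZ n (a : C) (v : 'cV[C]_n) :
  sqn (a *: v) = ComplexField.Normc.normc a ^+ 2 * sqn v.
Proof.
apply: complexI; rewrite -sqnE trmxCZ -scalemxAl -scalemxAr scalerA mxE sqnE.
by rewrite rmorphM; congr (_ * _); rewrite mulrC -normCK rmorphXn.
Qed.

Lemma sqnZr n (a : R) (v : 'cV[C]_n) : sqn (a%:C *: v) = a ^+ 2 * sqn v.
Proof. by rewrite -!rdotE rdotZl rdotZr; ring. Qed.

Lemma sqn_isom m n (U : 'M[C]_(m, n)) v : U^t* *m U = 1%:M -> sqn (U *m v) = sqn v.
Proof. by move=> h; rewrite /sqn trmxCM mulmxA -(mulmxA _ _ U) h mulmx1. Qed.

(** Expand the squared norm of [t u - v] and divide by [t]. The free weight [t] lets this do the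
    work of Cauchy-Schwarz. *)
Lemma young_rdot n (u v : 'cV[C]_n) (t : R) : 0 < t ->
  2 * rdot u v <= t * sqn u + t^-1 * sqn v.
Proof.
move=> t0; have := sqn_ge0 (t%:C *: u + (-1)%:C *: v).
rewrite sqnD !sqnZr rdotZl rdotZr => h.
rewrite -(ler_pM2l t0) mulrDr (mulrA t t^-1) mulfV ?gt_eqF// mul1r.
by lra.
Qed.

Lemma sqn_triangle n (u v : 'cV[C]_n) (a b : R) : 0 <= a -> 0 <= b ->
  sqn u <= a ^+ 2 -> sqn v <= b ^+ 2 -> sqn (u + v) <= (a + b) ^+ 2.
Proof.
rewrite le_eqVlt => /predU1P[<-|a0].
  move=> b0 + hv; rewrite expr0n => hu.
  by rewrite (@sqn_eq0 _ u) ?add0r//; apply/eqP; rewrite eq_le hu sqn_ge0.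
rewrite le_eqVlt => /predU1P[<-|b0] hu hv.
  move: hv; rewrite expr0n => hv.
  by rewrite (@sqn_eq0 _ v) ?addr0//; apply/eqP; rewrite eq_le hv sqn_ge0.
(* The weight [b / a] makes both terms of Young's inequality at most [a * b]; it is why [a = 0] and
   [b = 0] are treated apart. *)
rewrite sqnD; have := young_rdot u v (divr_gt0 b0 a0) => h.
have h1 : b / a * sqn u <= b * a.
  by rewrite -mulrA ler_pM2l// mulrC ler_pdivrMr// -expr2.
have h2 : (b / a)^-1 * sqn v <= a * b.
  by rewrite invf_div -mulrA ler_pM2l// mulrC ler_pdivrMr// -expr2.
by rewrite sqrrD; lra.
Qed.

(** For [s >= 0] this bounds the operator norm of [M] by [s]; as a predicate it avoids forming a
    supremum. *)
Definition opnorm_le m n (s : R) (M : 'M[C]_(m, n)) : Prop :=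
  forall v, sqn (M *m v) <= s ^+ 2 * sqn v.

Lemma opnorm_le_adj m n s (M : 'M[C]_(m, n)) : 0 <= s ->
  opnorm_le s M -> opnorm_le s (M^t*).
Proof.
rewrite le_eqVlt => /predU1P[<-|s0] hM z; set y := M^t* *m z.
  have : M *m y = 0.
    apply: sqn_eq0; apply/eqP; rewrite eq_le sqn_ge0 andbT.
    by have := hM y; rewrite expr0n mul0r.
  move=> My; rewrite -[sqn y]rdotE -/y {1}/y -rdot_adj My.
  by rewrite /rdot mulmx0 mxE expr0n mul0r.
(* Young with weight [s ^+ 2] gives [2 |y|^2 <= s^2 |z|^2 + |y|^2]. *)
have e : sqn y = rdot z (M *m y) by rewrite rdot_adj.
have := young_rdot z (M *m y) (exprn_gt0 2 s0); rewrite -e => h.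
have : (s ^+ 2)^-1 * sqn (M *m y) <= sqn y.
  by rewrite mulrC ler_pdivrMr ?exprn_gt0// mulrC.
by lra.
Qed.

Lemma opnorm_le_mul m n p s t (M : 'M[C]_(m, n)) (P : 'M[C]_(n, p)) :
  opnorm_le s M -> opnorm_le t P -> opnorm_le (s * t) (M *m P).
Proof.
move=> hM hP v; rewrite -mulmxA; apply: le_trans (hM _) _.
by rewrite exprMn -(mulrA (s ^+ 2)) ler_wpM2l ?sqr_ge0.
Qed.

Lemma opnorm_le_isom m n (M : 'M[C]_(m, n)) : M^t* *m M = 1%:M -> opnorm_le 1 M.
Proof. by move=> hM v; rewrite sqn_isom// expr1n mul1r. Qed.

Lemma opnorm_leD m n s t (M P : 'M[C]_(m, n)) : 0 <= s -> 0 <= t ->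
  opnorm_le s M -> opnorm_le t P -> opnorm_le (s + t) (M + P).
Proof.
move=> s0 t0 hM hP v.
have e : sqn v = Num.sqrt (sqn v) ^+ 2 by rewrite sqr_sqrtr ?sqn_ge0.
rewrite mulmxDl e -exprMn mulrDl.
by apply: sqn_triangle; rewrite ?mulr_ge0 ?sqrtr_ge0// exprMn -e.
Qed.

Lemma opnorm_le_rdiag n s (x : 'rV[R]_n) :
  (forall i, (x 0 i) ^+ 2 <= s ^+ 2) -> opnorm_le s (rdiag x).
Proof.
move=> hx v; rewrite !sqn_coef mulr_sumr ler_sum// => i _.
rewrite mul_diag_mx !mxE; case: (v i 0) => a b /=.
rewrite !mul0r subr0 addr0 !exprMn -mulrDr.
by rewrite ler_wpM2r// addr_ge0 ?sqr_ge0.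
Qed.

Lemma unitaryC n (V : 'M[C]_n) : V \is unitarymx -> V^t* *m V = 1%:M.
Proof. by move=> /unitarymxP/mulmx1C. Qed.

Lemma unitaryP n (V : 'M[C]_n) : V^t* *m V = 1%:M -> V \is unitarymx.
Proof. by move=> /mulmx1C/unitarymxP. Qed.

Lemma opnorm_le_herm n s (V : 'M[C]_n) (x : 'rV[R]_n) : V \is unitarymx ->
  (forall i, (x 0 i) ^+ 2 <= s ^+ 2) -> opnorm_le s (V^t* *m rdiag x *m V).
Proof.
move=> hV hx v; rewrite -!mulmxA.
rewrite (sqn_isom _ (U := V^t*)) ?trmxCK; last exact/unitarymxP.
apply: le_trans (opnorm_le_rdiag hx _) _.
by rewrite sqn_isom// unitaryC.
Qed.

Lemma char_poly_conj n (U A : 'M[C]_n) : U \is unitarymx ->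
  char_poly (U^t* *m A *m U) = char_poly A.
Proof.
move=> hU; have QP : map_mx polyC (U^t*) *m map_mx polyC U = 1%:M.
  by rewrite -map_mxM /= (unitaryC hU) map_mx1.
rewrite /char_poly; have -> : char_poly_mx (U^t* *m A *m U) =
      map_mx polyC (U^t*) *m char_poly_mx A *m map_mx polyC U.
  rewrite /char_poly_mx mulmxBr mulmxBl -!map_mxM.
  by rewrite mul_mx_scalar -scalemxAl QP scalemx1.
by rewrite !det_mulmx mulrAC -det_mulmx QP det1 mul1r.
Qed.

Lemma sorted_nonincr n (x : 'rV[R]_n) :
  (forall i j : 'I_n, (i <= j)%N -> x 0 j <= x 0 i) ->
  sorted >=%R [seq x 0 i | i : 'I_n].
Proof.
move=> hx; apply/(sortedP 0) => i; rewrite size_map size_enum_ord => lti.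
pose j0 := Ordinal lti; rewrite !(nth_map j0) ?size_enum_ord// ?(ltnW lti)//.
all: rewrite -?enumT ?size_enum_ord ?(ltnW lti)//.
by apply: hx; rewrite !nth_enum_ord// ltnW.
Qed.

(** A split polynomial determines its roots up to order, and monotonicity fixes the order.
    Eigenvalue vectors are identified in this way below. *)
Lemma lambda_char n (A : 'M[C]_n) (x : 'rV[R]_n) : A \is hermsymmx ->
  (forall i j : 'I_n, (i <= j)%N -> x 0 j <= x 0 i) ->
  char_poly A = \prod_(i < n) ('X - ((x 0 i)%:C)%:P) -> lambda A = x.
Proof.
move=> hA hx; rewrite char_poly_lambda// => e.
have pe : perm_eq [seq (r%:C : C) | r <- [seq lambda A 0 i | i : 'I_n]]
                  [seq (r%:C : C) | r <- [seq x 0 i | i : 'I_n]].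
  apply: prod_XsubC_eq.
  by rewrite 2!big_map [in RHS]big_map [in RHS]big_map !big_enum /=.
have {}pe := perm_map_inj (@complexI _) pe.
have se : [seq lambda A 0 i | i : 'I_n] = [seq x 0 i | i : 'I_n].
  apply: (@sorted_eq _ (>=%R)) pe; last first.
  - exact: sorted_nonincr.
  - exact/sorted_nonincr/lambda_nonincreasing.
  - by move=> a b; rewrite andbC => /le_anti.
  - by move=> b a c /[swap]; apply: le_trans.
apply/rowP=> i.
have := congr1 (fun s => nth 0 s i) se.
by rewrite !(nth_map i) -?enumT ?size_enum_ord// !nth_ord_enum.
Qed.

Lemma rdiag_herm n (V : 'M[C]_n) (x : 'rV[R]_n) :
  V^t* *m rdiag x *m V \is hermsymmx.
Proof. by apply/hermP; rewrite !trmxCM trmxCK trmxC_rdiag mulmxA. Qed.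

Lemma char_poly_rdiag n (x : 'rV[R]_n) :
  char_poly (rdiag x) = \prod_(i < n) ('X - ((x 0 i)%:C)%:P).
Proof.
rewrite char_poly_trig ?diag_mx_is_trig//.
by apply: eq_bigr => i _; rewrite rdiagE eqxx.
Qed.

Lemma lambda_rdiag n (V : 'M[C]_n) (x : 'rV[R]_n) : V \is unitarymx ->
  (forall i j : 'I_n, (i <= j)%N -> x 0 j <= x 0 i) ->
  lambda (V^t* *m rdiag x *m V) = x.
Proof.
move=> hV hx; apply: lambda_char => //; first exact: rdiag_herm.
by rewrite char_poly_conj// char_poly_rdiag.
Qed.

Lemma lambda_conj n (U A : 'M[C]_n) : A \is hermsymmx -> U \is unitarymx ->
  lambda (U^t* *m A *m U) = lambda A.
Proof.
move=> hA hU; apply: lambda_char; last by rewrite char_poly_conj// char_poly_lambda.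
  by apply/hermP; rewrite !trmxCM trmxCK (hermP A).1// mulmxA.
by move=> i j; apply: lambda_nonincreasing.
Qed.

(** The spectral theorem lists the eigenvalues in no particular order; the sorting permutation [p]
    is absorbed into the unitary [S *m P]. *)
Lemma herm_diagonalize n (A : 'M[C]_n) : A \is hermsymmx ->
  exists2 V, V \is unitarymx & A = V^t* *m rdiag (lambda A) *m V.
Proof.
move=> hA; have /hermitian_normalmx/orthomx_spectralP := hA.
rewrite invmx_unitary ?spectral_unitarymx//.
set P := spectralmx A; set D := spectral_diag A => e.
have hP : P \is unitarymx by exact: spectral_unitarymx.
have /tuple_permP[p hp] :
    perm_eq [tuple lambda A 0 i | i < n] [tuple complex.Re (D 0 j) | j < n].
  exact: lambda_perm.
have {}hp i : (lambda A 0 i)%:C = D 0 (p i).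
  have := congr1 (fun t => tnth t i) (val_inj hp).
  rewrite !tnth_mktuple => ->; apply: RRe_real.
  by have /mxOverP := hermitian_spectral_diag_real hA; apply.
pose S : 'M[C]_n := perm_mx p.
have hS : S \is unitarymx.
  apply/unitarymxP; rewrite tr_perm_mx map_perm_mx -perm_mxM mulgV perm_mx1.
  by [].
exists (S *m P); first by rewrite mul_unitarymx.
rewrite {1}e trmxCM !mulmxA; congr (_ *m _); rewrite -!mulmxA; congr (_ *m _).
have -> : rdiag (lambda A) = S *m diag_mx D *m S^t*.
  rewrite tr_perm_mx map_perm_mx -row_permE -[p]invgK -col_permE invgK.
  move: (lambda A) hp => L hp.
  apply/matrixP=> i j; rewrite rdiagE !mxE (inj_eq perm_inj) -hp.
  by case: eqP => [->|]; rewrite ?mulr1n ?mulr0n.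
by rewrite !mulmxA unitaryC// mul1mx -mulmxA unitaryC// mulmx1.
Qed.

End Euclidean.

(** * Polar decomposition *)

Section Polar.
Variable R : realType.
Local Notation C := R[i].

Lemma unitarymx1 n : (1%:M : 'M[C]_n) \is unitarymx.
Proof. by apply/unitarymxP; rewrite mul1mx trmxC_scalar rmorph1. Qed.

Lemma rdiag_delta n (x : 'rV[R]_n) i :
  rdiag x *m delta_mx i 0 = (x 0 i)%:C *: (delta_mx i 0 : 'cV[C]_n).
Proof.
apply/matrixP=> a b; rewrite mul_diag_mx !mxE ord1 eqxx andbT.
by case: eqP => [->|]; rewrite ?mulr0.
Qed.

Lemma unitary_conjM n (V A B : 'M[C]_n) : V \is unitarymx ->
  (V^t* *m A *m V) *m (V^t* *m B *m V) = V^t* *m (A *m B) *m V.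
Proof. by move=> /unitarymxP h; rewrite -!mulmxA (mulmxA V) h mul1mx. Qed.

Lemma unitary_adj n (V : 'M[C]_n) : V \is unitarymx -> V^t* \is unitarymx.
Proof. by rewrite trmxC_unitary. Qed.

Lemma sqn_col m n (M : 'M[C]_(m, n)) j : (sqn (col j M))%:C = (M^t* *m M) j j.
Proof. by rewrite -sqnE !mxE; apply: eq_bigr => i _; rewrite !mxE. Qed.

(** The positive factor [P] is the square root of [M^t* *m M], and [U] is [M] times its inverse [Q].
    Invertibility of [M] makes the eigenvalues [mu] positive. *)
Lemma polar n (M : 'M[C]_n) : M \in unitmx ->
  exists U V : 'M[C]_n, exists p : 'rV[R]_n,
  [/\ U \is unitarymx, V \is unitarymx, forall i, 0 < p 0 i &
      M = U *m (V^t* *m rdiag p *m V)].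
Proof.
move=> hM; have hB : M^t* *m M \is hermsymmx by apply/hermP; rewrite trmxCM trmxCK.
have [V hV] := herm_diagonalize hB; set mu := lambda _ => e.
have VV := unitaryC hV; have VV' := unitarymxP hV.
have e' : (M *m V^t*)^t* *m (M *m V^t*) = rdiag mu.
  rewrite trmxCM trmxCK mulmxA -(mulmxA V) e !mulmxA VV' mul1mx -mulmxA VV'.
  by rewrite mulmx1.
have hMV : M *m V^t* \in unitmx.
  by rewrite unitmx_mul hM unitarymx_unit ?trmxC_unitary ?hV.
have mu0 i : 0 < mu 0 i.
  rewrite -ltcR; have := sqn_col (M *m V^t*) i.
  rewrite e' rdiagE eqxx => <-; rewrite ltcR sqn_gt0//.
  apply/negP => /eqP; rewrite colE => /(congr1 (mulmx (invmx (M *m V^t*)))).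
  rewrite mulKmx// mulmx0 => /matrixP/(_ i 0); rewrite !mxE !eqxx => /eqP.
  by rewrite oner_eq0.
pose p : 'rV[R]_n := \row_i Num.sqrt (mu 0 i).
pose q : 'rV[R]_n := \row_i (p 0 i)^-1.
have p0 i : 0 < p 0 i by rewrite mxE sqrtr_gt0.
have pq : rdiag p *m rdiag q = 1%:M.
  rewrite rdiagM -(rdiag_const n 1); congr rdiag; apply/rowP => i.
  by rewrite mxE [q 0 i]mxE mulfV ?gt_eqF// [RHS]mxE.
have qp : rdiag q *m rdiag p = 1%:M by rewrite (mulmx1C pq).
have pp : rdiag mu = rdiag p *m rdiag p.
  rewrite rdiagM; congr rdiag; apply/rowP => i.
  by rewrite [RHS]mxE [p 0 i]mxE -expr2 sqr_sqrtr// ltW.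
pose P := V^t* *m rdiag p *m V; pose Q := V^t* *m rdiag q *m V.
have PQ : P *m Q = 1%:M by rewrite (unitary_conjM _ _ hV) pq mulmx1.
have QP : Q *m P = 1%:M by rewrite (mulmx1C PQ).
have QC : Q^t* = Q by apply/hermP/rdiag_herm.
have eP : M^t* *m M = P *m P by rewrite e pp (unitary_conjM _ _ hV).
exists (M *m Q), V, p; split; first last.
- by rewrite -/P -mulmxA QP mulmx1.
- exact: p0.
- exact: hV.
apply: unitaryP; rewrite trmxCM QC mulmxA -(mulmxA Q) eP.
by rewrite mulmxA QP mul1mx PQ.
Qed.

(** Polar decomposition reduces this to a positive diagonal matrix. It lets unitary invariance and
    the triangle inequality control products with matrices that are not unitary. *)
Lemma half_sum_unitary n (M : 'M[C]_n) (s : R) : M \in unitmx -> 0 < s ->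
  opnorm_le s M -> exists U W : 'M[C]_n, [/\ U \is unitarymx, W \is unitarymx &
    M = (s / 2)%:C *: (U + W)].
Proof.
move=> hM s0 hs; have [U [V [p [hU hV p0 e]]]] := polar hM.
(* [p i / s] lies in [0, 1], hence is the real part of a complex unit. *)
pose x i := p 0 i / s.
(* Column [i] of [V^t*] is a unit vector that [M] stretches by exactly [p 0 i]. *)
have x1 i : x i ^+ 2 <= 1.
  rewrite expr_div_n ler_pdivrMr ?exprn_gt0// mul1r.
  have := hs (col i (V^t*)).
  have -> : M *m col i (V^t*) = (p 0 i)%:C *: (U *m col i (V^t*)).
    rewrite colE e -!mulmxA (mulmxA V) (unitarymxP hV) mul1mx rdiag_delta.
    by rewrite -!scalemxAr.
  rewrite sqnZr sqn_isom ?unitaryC//.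
  suff -> : sqn (col i (V^t*)) = 1 by rewrite !mulr1.
  by apply: complexI; rewrite sqn_col trmxCK (unitarymxP hV) mxE eqxx.
pose y i := Num.sqrt (1 - x i ^+ 2).
have y2 i : y i ^+ 2 = 1 - x i ^+ 2 by rewrite sqr_sqrtr// subr_ge0.
pose D1 : 'M[C]_n := diag_mx (\row_i (x i +i* y i)).
pose D2 : 'M[C]_n := diag_mx (\row_i (x i -i* y i)).
have D12 : D1^t* = D2.
  apply/matrixP=> i j; rewrite !mxE eq_sym; case: eqP => [->|_]; rewrite ?mulr1n//.
  by rewrite !mulr0n rmorph0.
have D1u : D1 \is unitarymx.
  apply/unitarymxP; rewrite D12 mulmx_diag -diag_const_mx; congr diag_mx.
  apply/rowP=> i; rewrite !mxE; apply/eqP; rewrite eq_complex /= mulrN opprK.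
  by rewrite -!expr2 y2 addrC subrK eqxx mulrC mulNr addNr eqxx.
have D2u : D2 \is unitarymx by rewrite -D12 trmxC_unitary.
have hW := unitary_adj hV.
exists (U *m (V^t* *m D1 *m V)), (U *m (V^t* *m D2 *m V)); split.
- exact: mul_unitarymx hU (mul_unitarymx (mul_unitarymx hW D1u) hV).
- exact: mul_unitarymx hU (mul_unitarymx (mul_unitarymx hW D2u) hV).
rewrite -mulmxDr -mulmxDl -mulmxDr {1}e scalemxAr; congr (_ *m _).
rewrite scalemxAl scalemxAr; congr (_ *m _ *m _).
apply/matrixP=> i j; rewrite rdiagE !mxE; case: eqP => [->|_]; last first.
  by rewrite !mulr0n addr0 mulr0.
rewrite !mulr1n; apply/eqP; rewrite eq_complex /= subrr !mulr0 mul0r addr0.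
rewrite subr0 eqxx andbT /x; apply/eqP.
by field; rewrite gt_eqF.
Qed.

(** The shift by [t] is singular only if [-t] is an eigenvalue. The list [rs] has
    [size (char_poly M)] distinct candidates, one more than the degree, so not all are roots. *)
Lemma shift_unitmx n (M : 'M[C]_n) (e : R) : 0 < e ->
  exists t : R, [/\ 0 < t, t <= e & M + (t%:C)%:M \in unitmx].
Proof.
move=> e0; pose f (j : nat) : C := (- (e / j.+1%:R))%:C.
pose rs := [seq f j | j <- iota 0 (size (char_poly M))].
have hu : uniq rs.
  rewrite map_inj_uniq ?iota_uniq// => j k /complexI/oppr_inj.
  move=> /(mulfI (lt0r_neq0 e0))/invr_inj/eqP; rewrite eqr_nat => /eqP[].
  by [].
have p0 : char_poly M != 0 by rewrite monic_neq0// char_poly_monic.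
have /allPn[_ /mapP[j _ ->]] : ~~ all (root (char_poly M)) rs.
  by apply/negP => h; have := max_poly_roots p0 h hu; rewrite size_map size_iota ltnn.
rewrite -eigenvalue_root_char /eigenvalue /eigenspace negbK kermx_eq0 row_free_unit.
rewrite /f rmorphN /= raddfN opprK => h; exists (e / j.+1%:R); split=> //.
  by rewrite divr_gt0.
by rewrite ler_pdivrMr// ler_peMr ?(ltW e0)// (ler_nat _ 1).
Qed.

End Polar.

(** A limit [t -> 0] along a sparse set of [t], namely the shifts that make a matrix invertible. *)
Lemma le_of_small (F : realFieldType) (a b c : F) : 0 <= c ->
  (forall e, 0 < e -> exists t, [/\ 0 < t, t <= e & a <= b + t * c]) -> a <= b.
Proof.
move=> c0 h; apply/ler_addgt0Pr => e e0.
have c1 : 0 < c + 1 by rewrite ltr_wpDl.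
have [t [t0 te h']] := h (e / (c + 1)) (divr_gt0 e0 c1).
apply: le_trans h' _; rewrite lerD2l.
apply: le_trans (_ : e / (c + 1) * (c + 1) <= _); last by rewrite divfK// gt_eqF.
by rewrite ler_pM// ?ltW// ltrDl.
Qed.

(** * Unitarily invariant norms *)

Section Norm.
Variables (R : realType) (d : nat).
Local Notation C := R[i].
Variable N : 'M[C]_d -> R.
Hypothesis hN : unitarily_invariant_norm N.

Lemma uinZr (a : R) B : 0 <= a -> N (a%:C *: B) = a * N B.
Proof.
move=> a0; rewrite (uinZ hN); congr (_ * _).
by rewrite /= expr0n addr0 sqrtr_sqr ger0_norm.
Qed.

Lemma uin0 : N 0 = 0.
Proof. by have := @uinZr 0 0 (lexx _); rewrite scaler0 mul0r. Qed.

Lemma uinN B : N (- B) = N B.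
Proof.
rewrite -scaleN1r (uinZ hN) /= oppr0 expr0n addr0 sqrtr_sqr normrN1.
by rewrite mul1r.
Qed.

Lemma uinB B1 B2 : N (B1 - B2) <= N B1 + N B2.
Proof. by apply: le_trans (uin_triangle hN _ _) _; rewrite uinN. Qed.

Lemma uin_unitaryl U B : U \is unitarymx -> N (U *m B) = N B.
Proof.
by move=> hU; have := uin_unitary hN B hU (unitarymx1 R d); rewrite mulmx1.
Qed.

Lemma uin_unitaryr U B : U \is unitarymx -> N (B *m U) = N B.
Proof.
by move=> hU; have := uin_unitary hN B (unitarymx1 R d) hU; rewrite mul1mx.
Qed.

Lemma opnorm_le_shift n s t (M : 'M[C]_n) : 0 <= s -> 0 <= t -> opnorm_le s M ->
  opnorm_le (s + t) (M + (t%:C)%:M).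
Proof.
move=> s0 t0 hM; apply: opnorm_leD => // v.
by rewrite mul_scalar_mx sqnZr.
Qed.

(** After a small shift [M] is invertible, hence [(s + t) / 2] times a sum of two unitaries; undoing
    the shift brings the total error to [2 t N(B)]. *)
Lemma uin_mull_le M s B : 0 <= s -> opnorm_le s M -> N (M *m B) <= s * N B.
Proof.
move=> s0 hM; apply: (@le_of_small _ _ _ (N B *+ 2)).
  by rewrite mulrn_wge0// (uin_ge0 hN).
move=> e e0; have [t [t0 te hu]] := shift_unitmx M e0; exists t; split=> //.
have st0 : 0 < s + t by rewrite ltr_wpDl.
have [U [W [hU hW eM]]] := half_sum_unitary hu st0 (opnorm_le_shift s0 (ltW t0) hM).
have -> : M *m B = (M + (t%:C)%:M) *m B - t%:C *: B.
  by rewrite mulmxDl mul_scalar_mx addrK.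
apply: le_trans (uinB _ _) _; rewrite uinZr ?(ltW t0)// eM -scalemxAl uinZr; last first.
  by rewrite divr_ge0// ltW.
have : N ((U + W) *m B) <= N B *+ 2.
  rewrite mulmxDl; apply: le_trans (uin_triangle hN _ _) _.
  by rewrite (uin_unitaryl _ hU) (uin_unitaryl _ hW) mulr2n.
move=> /(ler_wpM2l (ltW (divr_gt0 st0 (ltr0n _ 2)))).
by rewrite -[N B *+ 2]mulr_natl; lra.
Qed.

(** For an invertible matrix [U P] with [P] self-adjoint, both it and its adjoint [P U^t*] have the
    norm of [P]. Small shifts extend this to all [B]. *)
Lemma uin_adj_le B : N (B^t*) <= N B.
Proof.
apply: (@le_of_small _ _ _ (N 1%:M *+ 2)).
  by rewrite mulrn_wge0// (uin_ge0 hN).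
move=> e e0; have [t [t0 te hu]] := shift_unitmx B e0; exists t; split=> //.
have [U [V [p [hU hV p0 e1]]]] := polar hu.
have -> : B^t* = (B + (t%:C)%:M)^t* - t%:C *: 1%:M.
  by rewrite trmxCD trmxC_scalar conj_real scalemx1 addrK.
apply: le_trans (uinB _ _) _; rewrite uinZr ?(ltW t0)//.
have -> : N ((B + (t%:C)%:M)^t*) = N (B + (t%:C)%:M).
  set P := _ *m V in e1; have hP : P^t* = P by apply/hermP/rdiag_herm.
  by rewrite e1 trmxCM hP (uin_unitaryl _ hU) (uin_unitaryr _ (unitary_adj hU)).
have : N (B + (t%:C)%:M) <= N B + t * N 1%:M.
  apply: le_trans (uin_triangle hN _ _) _.
  by rewrite -(scalemx1 _ t%:C) (uinZr _ (ltW t0)).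
by rewrite -[N 1%:M *+ 2]mulr_natl; lra.
Qed.

Lemma uin_adj B : N (B^t*) = N B.
Proof.
by apply: le_anti; rewrite uin_adj_le /= -{1}[B]trmxCK uin_adj_le.
Qed.

Lemma uin_mulr_le M s B : 0 <= s -> opnorm_le s M -> N (B *m M) <= s * N B.
Proof.
move=> s0 hM; rewrite -uin_adj trmxCM -[N B]uin_adj.
by apply: uin_mull_le => //; apply: opnorm_le_adj.
Qed.

(** [N] dominates the operator norm. With [e] a basis vector, multiplying [B] by [e w^t*] on the
    left and by [r e^t*] on the right gives [|r|^2 E_ii]; the two factors have operator norms at
    most [|w|] and [|r|], so normalization yields [|r|^2 <= |w| |r| N(B)]. *)
Lemma sqn_le_uin B (w : 'cV[C]_d) : normalized N ->
  sqn (B^t* *m w) <= sqn w * N B ^+ 2.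
Proof.
move=> hN1; set r := B^t* *m w.
(* In dimension zero there is no [E_ii] to test on, but every vector vanishes. *)
have [d0|[i _]] : d = 0%N \/ exists i : 'I_d, True.
- by case: d => [|d']; [left|right; exists ord0].
- suff -> : r = 0 by rewrite sqn0 mulr_ge0 ?sqn_ge0 ?sqr_ge0.
  by apply/matrixP=> a; have := ltn_ord a; rewrite {2}d0.
pose e : 'cV[C]_d := delta_mx i 0.
have oM (v : 'cV[C]_d) : opnorm_le (Num.sqrt (sqn v)) (v *m e^t*).
  move=> u; rewrite sqr_sqrtr ?sqn_ge0// -mulmxA [e^t* *m u]mx11_scalar.
  rewrite mul_mx_scalar sqnZ mulrC ler_wpM2l ?sqn_ge0// sqn_coef (bigD1 i)//=.
  have -> : (e^t* *m u) 0 0 = u i 0.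
    rewrite mxE (bigD1 i)//= big1 ?addr0 => [|j /negPf hj].
      by rewrite !mxE !eqxx rmorph1 mul1r.
    by rewrite !mxE hj rmorph0 mul0r.
  rewrite -[X in X <= _]addr0 lerD ?sumr_ge0// => [|j _]; last first.
    by rewrite addr_ge0 ?sqr_ge0.
  by case: (u i 0) => a b /=; rewrite sqr_sqrtr ?addr_ge0 ?sqr_ge0.
have oM' v := opnorm_le_adj (sqrtr_ge0 _) (oM v).
have := uin_mull_le B (sqrtr_ge0 _) (oM' w).
rewrite trmxCM trmxCK => h1.
have := uin_mulr_le (e *m w^t* *m B) (sqrtr_ge0 _) (oM r).
have -> : e *m w^t* *m B *m (r *m e^t*) = (sqn r)%:C *: delta_mx i i.
  have er : w^t* *m B = r^t* by rewrite trmxCM trmxCK.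
  rewrite mulmxA -(mulmxA e) er -(mulmxA e) [r^t* *m r]mx11_scalar sqnE.
  rewrite mul_mx_scalar -scalemxAl; congr (_ *: _).
  apply/matrixP=> a b; rewrite mxE big_ord1 !mxE eqxx !andbT.
  by rewrite -mulnb natrM; congr (_ * _); rewrite rmorph_nat.
rewrite uinZr ?sqn_ge0// => h2.
have {h1}h2 := le_trans h2 (ler_wpM2l (sqrtr_ge0 _) h1).
have h3 := le_trans (ler_peMr (sqn_ge0 _) (hN1 i)) h2.
have [r0|r0] := eqVneq r 0; first by rewrite r0 sqn0 mulr_ge0 ?sqn_ge0 ?sqr_ge0.
have {r0}r0 : 0 < Num.sqrt (sqn r) by rewrite sqrtr_gt0 sqn_gt0.
move: h3; rewrite -[X in X <= _](sqr_sqrtr (sqn_ge0 r)) expr2 (ler_pM2l r0) => h3.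
rewrite -(sqr_sqrtr (sqn_ge0 r)) -(sqr_sqrtr (sqn_ge0 w)) -exprMn.
by rewrite lerXn2r// nnegrE ?mulr_ge0 ?sqrtr_ge0 ?(uin_ge0 hN).
Qed.

End Norm.

(** * Majorization *)

Section Majorization.
Variables (F : realFieldType) (n : nat) (phi : 'rV[F]_n -> F).
Hypothesis phi_convex : forall (t : F) x y, 0 <= t <= 1 ->
  phi (t *: x + (1 - t) *: y) <= t * phi x + (1 - t) * phi y.
Hypothesis phi_sym : forall (s : 'S_n) x, phi (col_perm s x) = phi x.

(** With [u = D / (g j - g k)] in [0, 1], the new vector is [(1 - u) g] plus [u] times [g] with
    coordinates [j] and [k] exchanged. *)
Lemma transfer_le (g : 'rV[F]_n) (j k : 'I_n) (D : F) : j != k ->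
  0 <= D -> D <= g 0 j - g 0 k -> 0 < g 0 j - g 0 k ->
  phi (\row_i (g 0 i - D *+ (i == j) + D *+ (i == k))) <= phi g.
Proof.
move=> jk D0 Dle gjk; set g' := \row_i _; pose u := D / (g 0 j - g 0 k).
have u01 : 0 <= 1 - u <= 1.
  by rewrite subr_ge0 ler_pdivrMr// mul1r Dle gerBl divr_ge0// ltW.
have eu : 1 - (1 - u) = u by rewrite opprB addrC subrK.
have uD : u * (g 0 j - g 0 k) = D by rewrite divfK// gt_eqF.
have -> : g' = (1 - u) *: g + (1 - (1 - u)) *: col_perm (tperm j k) g.
  apply/rowP=> i; rewrite !mxE eu permE /= -uD.
  have [->|ij] := eqVneq i j; first by rewrite (negPf jk) mulr1n mulr0n; ring.
  have [->|ik] := eqVneq i k; first by rewrite mulr1n mulr0n; ring.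
  by rewrite !mulr0n; ring.
apply: le_trans (phi_convex _ _ u01) _.
by rewrite phi_sym -mulrDl addrC subrK mul1r.
Qed.

Lemma sum_pred1 (P : pred 'I_n) (D : F) j :
  \sum_(i | P i) D *+ (i == j) = D *+ (P j).
Proof.
rewrite big_mkcond (bigD1 j)//= eqxx big1 ?addr0 => [|i /negPf ->].
  by case: (P j).
by rewrite mulr0n if_same.
Qed.

(* Muirhead's transfers: moving mass from a coordinate where [g > d] to a later
   one where [g < d] replaces [g] by an average of [g] and a transposition of
   it, keeps the hypotheses and creates a new coordinate where [g = d]. *)
Lemma majorization_le (d g : 'rV[F]_n) :
  (forall i j : 'I_n, (i <= j)%N -> d 0 j <= d 0 i) ->
  (forall m, (m <= n)%N ->
     \sum_(i < n | (i < m)%N) d 0 i <= \sum_(i < n | (i < m)%N) g 0 i) ->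
  \sum_i d 0 i = \sum_i g 0 i -> phi d <= phi g.
Proof.
move=> dn; have [c] := ubnP #|[set i | d 0 i != g 0 i]|.
elim: c g => // c IH g; rewrite ltnS => hc hm ht.
have [/existsP[k0 hk0]|/existsPn hall] := boolP [exists k, g 0 k < d 0 k]; last first.
  have dg k : d 0 k <= g 0 k by rewrite leNgt hall.
  suff -> : d = g by [].
  have : \sum_i (g 0 i - d 0 i) = 0 by rewrite sumrB ht subrr.
  move/psumr_eq0P => h; apply/rowP=> i; apply/eqP.
  by rewrite eq_sym -subr_eq0 h// => k _; rewrite subr_ge0.
(* Take the first deficient coordinate [k], so that [d <= g] everywhere before it. *)
have := @arg_minnP _ k0 (fun k => g 0 k < d 0 k) (@nat_of_ord n) hk0.
case => k /= hk kmin {k0 hk0}.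
have dg (i : 'I_n) : (i < k)%N -> d 0 i <= g 0 i.
  by move=> ik; rewrite leNgt; apply/negP => /kmin; rewrite leqNgt ik.
(* Otherwise the partial sum of [g] through [k] would fall short of that of [d]. *)
have [j jk hj] : exists2 j : 'I_n, (j < k)%N & d 0 j < g 0 j.
  have [/existsP[j /andP[]]|/existsPn h] :=
    boolP [exists j : 'I_n, (j < k)%N && (d 0 j < g 0 j)]; first by exists j.
  exfalso; have := hm k.+1 (ltn_ord k); rewrite leNgt => /negP[].
  rewrite [X in _ < X](bigD1 k)//= [X in X < _](bigD1 k)//= ltr_leD// ler_sum// => i.
  rewrite ltnS => /andP[ik nik]; have {}ik : (i < k)%N by rewrite ltn_neqAle nik.
  by have := h i; rewrite ik /= leNgt.
have njk : j != k by apply: contraTneq jk => ->; rewrite ltnn.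
(* With the smaller of the two gaps neither coordinate overshoots, and one attaining the minimum
   becomes equal to [d]. *)
pose D := Num.min (g 0 j - d 0 j) (d 0 k - g 0 k).
have D0 : 0 <= D by rewrite le_min !subr_ge0 !ltW.
have Dj : D <= g 0 j - d 0 j by rewrite ge_min lexx.
have Dk : D <= d 0 k - g 0 k by rewrite ge_min lexx orbT.
have djk : d 0 k <= d 0 j by apply: dn; exact: ltnW.
have gjk : 0 < g 0 j - g 0 k by lra.
have Dgjk : D <= g 0 j - g 0 k by lra.
apply: le_trans (transfer_le njk D0 Dgjk gjk); apply: IH; last first.
- rewrite ht; under [RHS]eq_bigr do rewrite mxE.
  by rewrite big_split sumrB /= !sum_pred1 subrK.
- move=> m mn; under [leRHS]eq_bigr do rewrite mxE.
  rewrite big_split sumrB /= !sum_pred1.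
  have [mj|jm] := leqP m j.
    by rewrite (leq_gtF (leq_trans mj (ltnW jk))) subr0 addr0 hm.
  have [mk|_] := leqP m k; last by rewrite subrK hm.
  (* For [j < m <= k] the partial sum of [g] loses [D], which the surplus at [j] alone covers; the
     other surpluses before [m] are nonnegative. *)
  rewrite mulr1n mulr0n addr0 lerBrDr -lerBrDl -sumrB (bigD1 j)//=.
  rewrite -[D]addr0 lerD// sumr_ge0// => i /andP[im _].
  by rewrite subr_ge0 dg// (leq_trans im).
have [l lP l0] : exists2 l : 'I_n, d 0 l != g 0 l &
    d 0 l = g 0 l - D *+ (l == j) + D *+ (l == k).
  rewrite /D /Num.min; case: ifP => _; [exists j|exists k].
  - by rewrite lt_eqF.
  - by rewrite eqxx (negPf njk) mulr1n mulr0n addr0 opprB addrC subrK.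
  - by rewrite gt_eqF.
  - by rewrite eqxx eq_sym (negPf njk) mulr1n mulr0n subr0 addrC subrK.
apply: leq_trans hc; apply: proper_card; apply/properP; split.
  apply/subsetP => i; rewrite !inE mxE; apply: contraNN => /eqP dgi.
  have [ij|ij] := eqVneq i j; first by move: hj; rewrite -ij dgi ltxx.
  have [ik|ik] := eqVneq i k; first by move: hk; rewrite -ik dgi ltxx.
  by rewrite !mulr0n subr0 addr0 dgi.
by exists l; rewrite !inE ?mxE// -l0 eqxx.
Qed.

End Majorization.

(** * Eigenvalue inequalities *)

Section Eigenvalues.
Variable R : realType.
Local Notation C := R[i].
Implicit Types n : nat.

Lemma rdot_rdiag n (a : 'rV[R]_n) (x : 'cV[C]_n) :
  rdot x (rdiag a *m x) =
  \sum_j a 0 j * (complex.Re (x j 0) ^+ 2 + complex.Im (x j 0) ^+ 2).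
Proof.
rewrite /rdot mul_diag_mx mxE raddf_sum; apply: eq_bigr => j _; rewrite !mxE.
by case: (x j 0) => p q /=; ring.
Qed.

Lemma rdot_conj n (V M : 'M[C]_n) (x : 'cV[C]_n) :
  rdot x (V^t* *m M *m V *m x) = rdot (V *m x) (M *m (V *m x)).
Proof. by rewrite /rdot trmxCM !mulmxA. Qed.

(** A dimension count replaces the min-max principle: on one nonzero [x] the form of [A] is at least
    [lambda A 0 i * sqn x] and that of [B] at most [lambda B 0 i * sqn x]. *)
Lemma weyl_monotone n (A B : 'M[C]_n) : A \is hermsymmx -> B \is hermsymmx ->
  (forall v, rdot v (A *m v) <= rdot v (B *m v)) ->
  forall i, lambda A 0 i <= lambda B 0 i.
Proof.
move=> hA hB AB i; rewrite leNgt; apply/negP => lti.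
have [V hV eA] := herm_diagonalize hA; have [W hW eB] := herm_diagonalize hB.
(* A nonzero [x] killed by [K], whose [i]-th row is zero, lies in the span of the
   eigenvectors of [A] of index [<= i] and of those of [B] of index [>= i]. *)
pose K := \matrix_(j < n, l < n)
  (if (j < i)%N then W j l else if (i < j)%N then V j l else 0).
have /det0P[y y0 Ky] : \det K^T == 0.
  rewrite det_tr; apply/det0P; exists (delta_mx 0 i).
    apply/negP => /eqP/matrixP/(_ 0 i); rewrite !mxE !eqxx => /eqP.
    by rewrite oner_eq0.
  by rewrite -rowE; apply/rowP=> l; rewrite !mxE ltnn.
have Kx j : (K *m y^T) j 0 = 0 by rewrite -[K]trmxK -trmx_mul Ky !mxE.
pose x := y^T; have x0 : x != 0 by rewrite trmx_eq0.
have Vx (j : 'I_n) : (i < j)%N -> (V *m x) j 0 = 0.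
  move=> ij; rewrite -[RHS](Kx j) !mxE; apply: eq_bigr => l _.
  by rewrite !mxE ij ltnNge (ltnW ij).
have Wx (j : 'I_n) : (j < i)%N -> (W *m x) j 0 = 0.
  by move=> ij; rewrite -[RHS](Kx j) !mxE; apply: eq_bigr => l _; rewrite !mxE ij.
have hAx : lambda A 0 i * sqn x <= rdot x (A *m x).
  rewrite {2}eA rdot_conj rdot_rdiag -(sqn_isom x (unitaryC hV)) sqn_coef mulr_sumr.
  apply: ler_sum => j _; have [ji|ij] := leqP j i.
    by rewrite ler_wpM2r ?addr_ge0 ?sqr_ge0// lambda_nonincreasing.
  by rewrite Vx//= expr0n addr0 !mulr0.
have hBx : rdot x (B *m x) <= lambda B 0 i * sqn x.
  rewrite {1}eB rdot_conj rdot_rdiag -(sqn_isom x (unitaryC hW)) sqn_coef mulr_sumr.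
  apply: ler_sum => j _; have [ij|ji] := leqP i j.
    by rewrite ler_wpM2r ?addr_ge0 ?sqr_ge0// lambda_nonincreasing.
  by rewrite Wx//= expr0n addr0 !mulr0.
have := le_trans hAx (le_trans (AB x) hBx); rewrite ler_pM2r ?sqn_gt0//.
by rewrite leNgt lti.
Qed.

Lemma mxtrace_conj_rdiag n (V : 'M[C]_n) (x : 'rV[R]_n) : V \is unitarymx ->
  \tr (V^t* *m rdiag x *m V) = (\sum_i x 0 i)%:C.
Proof.
move=> hV; rewrite mxtrace_mulC mulmxA (unitarymxP hV) mul1mx mxtrace_diag rmorph_sum.
by apply: eq_bigr => i _; rewrite mxE.
Qed.

Lemma mxtrace_lambda n (A : 'M[C]_n) : A \is hermsymmx ->
  \tr A = (\sum_i lambda A 0 i)%:C.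
Proof.
move=> hA; have [V hV {1}->] := herm_diagonalize hA.
exact: mxtrace_conj_rdiag.
Qed.

Lemma lambda_shift n (A : 'M[C]_n) (c : R) i : A \is hermsymmx ->
  lambda (A + (c%:C)%:M) 0 i = lambda A 0 i + c.
Proof.
move=> hA; have [V hV e] := herm_diagonalize hA.
have -> : A + (c%:C)%:M = V^t* *m rdiag (lambda A + const_mx c) *m V.
  rewrite rdiagD rdiag_const mulmxDr mulmxDl -e mul_mx_scalar -scalemxAl.
  by rewrite (unitaryC hV) scalemx1.
rewrite lambda_rdiag// => [|{}i j ij]; first by rewrite mxE [const_mx _ _ _]mxE.
rewrite mxE [leRHS]mxE ![const_mx _ _ _]mxE lerD2r.
exact: lambda_nonincreasing.
Qed.

Lemma hermD n (A B : 'M[C]_n) : A \is hermsymmx -> B \is hermsymmx ->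
  A + B \is hermsymmx.
Proof. by move=> /hermP hA /hermP hB; apply/hermP; rewrite trmxCD hA hB. Qed.

Lemma hermB n (A B : 'M[C]_n) : A \is hermsymmx -> B \is hermsymmx ->
  A - B \is hermsymmx.
Proof. by move=> /hermP hA /hermP hB; apply/hermP; rewrite trmxCB hA hB. Qed.

Lemma herm_scalar n (c : R) : ((c%:C)%:M : 'M[C]_n) \is hermsymmx.
Proof. by apply/hermP; rewrite trmxC_scalar conj_real. Qed.

Lemma addr_subr_shift (V : zmodType) (h c x l : V) : h + c + x = l + (x + c - (l - h)).
Proof. by rewrite opprB [RHS]addrC addrA subrK [x + c]addrC [RHS]addrC addrA. Qed.

Lemma card_ord_lt n m : (m <= n)%N -> #|[pred i : 'I_n | (i < m)%N]| = m.
Proof.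
move=> mn; rewrite -sum1_card -(big_ord_widen n (fun=> 1%N) mn).
by rewrite sum1_card card_ord.
Qed.

(* Li and Mathias: with [c] the [#|I|]-th eigenvalue of [G = L - H], the matrix
   [L' = H + c + (G - c)_+] dominates both [L] and [H + c], so by Weyl monotonicity
   the sum over [I] is at most [c * #|I|] plus the trace of [(G - c)_+]. *)
Lemma lidskii n (H L : 'M[C]_n) (I : {set 'I_n}) :
  H \is hermsymmx -> L \is hermsymmx ->
  \sum_(i in I) (lambda L 0 i - lambda H 0 i) <=
  \sum_(i < n | (i < #|I|)%N) lambda (L - H) 0 i.
Proof.
move=> hH hL; have hG : L - H \is hermsymmx.
  exact: hermB.
set g := lambda (L - H).
have [I0|] := posnP #|I|.
  by rewrite I0 (cards0_eq I0) big_set0 big_pred0.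
have := max_card (mem I); rewrite card_ord; case eI : #|I| => [//|m] mn _.
(* Indices start at zero, so index [m = #|I| - 1] carries the [#|I|]-th largest eigenvalue. *)
pose i0 := Ordinal mn; pose c := g 0 i0.
pose h : 'rV[R]_n := \row_i Num.max (g 0 i - c) 0.
have [V hV e] := herm_diagonalize hG; rewrite -/g in e.
pose H' := H + (c%:C)%:M; pose L' := H' + V^t* *m rdiag h *m V.
have hH' : H' \is hermsymmx.
  exact: hermD hH (herm_scalar _ _).
have hL' : L' \is hermsymmx.
  exact: hermD hH' (rdiag_herm _ _).
have conj_ge0 (x : 'rV[R]_n) v : (forall i, 0 <= x 0 i) ->
    0 <= rdot v (V^t* *m rdiag x *m V *m v).
  move=> x0; rewrite rdot_conj rdot_rdiag sumr_ge0// => i _.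
  by rewrite mulr_ge0// addr_ge0 ?sqr_ge0.
(* [L' - L] is the conjugate of the diagonal [h + c - g], nonnegative by the choice of [h]. *)
have LL' i : lambda L 0 i <= lambda L' 0 i.
  apply: weyl_monotone => // v; rewrite -subr_ge0.
  have -> : L' = L + V^t* *m rdiag (h + const_mx c - g) *m V.
    rewrite rdiagB rdiagD rdiag_const mulmxBr mulmxDr mulmxBl mulmxDl -e.
    rewrite mul_mx_scalar -scalemxAl (unitaryC hV) scalemx1 /L' /H'.
    exact: addr_subr_shift.
  rewrite mulmxDl rdotDr addrC addKr conj_ge0// => j.
  by rewrite !mxE subr_ge0 -lerBlDr le_max lexx.
have HL' i : lambda H 0 i + c <= lambda L' 0 i.
  rewrite -(lambda_shift _ _ hH); apply: (weyl_monotone hH' hL') => v.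
  by rewrite [L' *m v]mulmxDl rdotDr lerDl conj_ge0// => j; rewrite mxE le_max lexx orbT.
have tL' : \sum_i (lambda L' 0 i - lambda H 0 i - c) = \sum_i h 0 i.
  transitivity (\sum_i (lambda L' 0 i - lambda H' 0 i)).
    by apply: eq_bigr => i _; rewrite lambda_shift// opprD addrA.
  apply: complexI; rewrite sumrB rmorphB /= -(mxtrace_lambda hL') -(mxtrace_lambda hH').
  by rewrite /L' mxtraceD (mxtrace_conj_rdiag _ hV) addrC addKr.
apply: le_trans (_ : \sum_(i in I) (lambda L' 0 i - lambda H 0 i - c + c) <= _).
  by apply: ler_sum => i _; rewrite subrK lerD2r.
rewrite big_split /= sumr_const eI.
(* By [HL'] all terms are nonnegative, so the sum may be extended from [I] to all indices, where
   [tL'] evaluates it as a trace. *)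
apply: le_trans (_ : \sum_i h 0 i + c *+ m.+1 <= _).
  rewrite lerD2r -tL' [leRHS](bigID (mem I))/= lerDl sumr_ge0// => i _.
  by rewrite -addrA -opprD subr_ge0.
(* Past index [m], [g <= c] and [h] vanishes; up to [m], [h = g - c], and the [m.+1] copies of [c]
   cancel. *)
rewrite (bigID (fun i : 'I_n => (i < m.+1)%N))/= [X in _ + X + _]big1 ?addr0; last first.
  move=> i; rewrite -leqNgt => mi; rewrite mxE; apply/max_idPr.
  by rewrite subr_le0; apply: lambda_nonincreasing; exact: ltnW.
rewrite (eq_bigr (fun i => g 0 i - c)) => [|i im]; last first.
  by rewrite mxE; apply/max_idPl; rewrite subr_ge0; exact: lambda_nonincreasing.
by rewrite sumrB sumr_const card_ord_lt// subrK.
Qed.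
End Eigenvalues.

(** * Padding and the Lidskii-Mirsky theorem *)

Section Mirsky.
Variables (R : realType) (d : nat).
Local Notation C := R[i].

Lemma padE m n (B : 'M[C]_(m, n)) :
  pad d B = (pid_mx m : 'M_(d, m)) *m B *m (pid_mx n : 'M_(d, n))^t*.
Proof. by rewrite tr_pid_mx map_pid_mx. Qed.

Lemma pid_isom n : (n <= d)%N ->
  (pid_mx n : 'M[C]_(d, n))^t* *m (pid_mx n : 'M_(d, n)) = 1%:M.
Proof.
by move=> nd; rewrite tr_pid_mx map_pid_mx mul_pid_mx minnn (minn_idPr nd) pid_mx_1.
Qed.

Lemma padD m n (A B : 'M[C]_(m, n)) : pad d (A + B) = pad d A + pad d B.
Proof. by rewrite /pad mulmxDr mulmxDl. Qed.

Lemma padZ m n a (A : 'M[C]_(m, n)) : pad d (a *: A) = a *: pad d A.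
Proof. by rewrite /pad -scalemxAr -scalemxAl. Qed.

Lemma padM m n p (A : 'M[C]_(m, n)) (B : 'M[C]_(n, p)) : (n <= d)%N ->
  pad d (A *m B) = pad d A *m pad d B.
Proof.
move=> nd; rewrite !padE !mulmxA.
by rewrite -(mulmxA _ (_^t*) (pid_mx n)) (pid_isom nd) mulmx1.
Qed.

Lemma pad_adj m n (A : 'M[C]_(m, n)) : pad d (A^t*) = (pad d A)^t*.
Proof. by rewrite !padE !trmxCM trmxCK mulmxA. Qed.

Lemma opnorm_le_pad m n s (A : 'M[C]_(m, n)) : (m <= d)%N -> (n <= d)%N ->
  opnorm_le s A -> opnorm_le s (pad d A).
Proof.
move=> md nd hA; rewrite padE -[s]mulr1 -[X in X * _]mul1r.
apply: opnorm_le_mul; first by apply: opnorm_le_mul hA; apply/opnorm_le_isom/pid_isom.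
by apply: opnorm_le_adj => //; apply/opnorm_le_isom/pid_isom.
Qed.

Variable N : 'M[C]_d -> R.
Hypothesis hN : unitarily_invariant_norm N.
Variable k : nat.
Hypothesis kd : (k <= d)%N.

(** For [k < d] the padded [V] is only a contraction, not a unitary, whence an inequality first;
    conjugating back gives the equality. *)
Lemma uin_pad_conj_le (V B : 'M[C]_k) : V \is unitarymx ->
  N (pad d (V^t* *m B *m V)) <= N (pad d B).
Proof.
move=> hV; rewrite !padM//.
have o1 : opnorm_le 1 (pad d V) by apply: opnorm_le_pad => //; apply/opnorm_le_isom/unitaryC.
have o2 : opnorm_le 1 (pad d (V^t*)).
  apply: opnorm_le_pad => //; apply/opnorm_le_isom; exact: unitaryC (unitary_adj hV).
apply: le_trans (uin_mulr_le hN _ ler01 o1) _; rewrite mul1r.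
by apply: le_trans (uin_mull_le hN _ ler01 o2) _; rewrite mul1r.
Qed.

Lemma uin_pad_conj (V B : 'M[C]_k) : V \is unitarymx ->
  N (pad d (V^t* *m B *m V)) = N (pad d B).
Proof.
move=> hV; apply: le_anti; rewrite uin_pad_conj_le//=.
have := uin_pad_conj_le (V^t* *m B *m V) (unitary_adj hV).
by rewrite trmxCK !mulmxA (unitarymxP hV) mul1mx -mulmxA (unitarymxP hV) mulmx1.
Qed.

(** By Lidskii the sorted difference of the spectra is majorized by [lambda (L - H)], and [phi],
    convex and permutation invariant, respects majorization. *)
Lemma mirsky (H L : 'M[C]_k) : H \is hermsymmx -> L \is hermsymmx ->
  N (pad_vec d (lambda L - lambda H)) <= N (pad d (L - H)).
Proof.
move=> hH hL; have hG := hermB hL hH; have [V hV eG] := herm_diagonalize hG.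
pose phi x := N (pad d (rdiag x : 'M[C]_k)).
rewrite [in leRHS]eG (uin_pad_conj _ hV) -/(phi _) -[leLHS]/(phi _).
set g := lambda (L - H); set u := lambda L - lambda H.
have phi_convex (t : R) x y : 0 <= t <= 1 ->
    phi (t *: x + (1 - t) *: y) <= t * phi x + (1 - t) * phi y.
  move=> /andP[t0 t1]; rewrite /phi rdiagD padD.
  apply: le_trans (uin_triangle hN _ _) _.
  by rewrite !rdiagZ !padZ !(uinZr hN) ?subr_ge0.
have phi_sym (s : 'S_k) x : phi (col_perm s x) = phi x.
  pose S : 'M[C]_k := perm_mx s.
  have hS : S \is unitarymx.
    by apply/unitarymxP; rewrite tr_perm_mx map_perm_mx -perm_mxM mulgV perm_mx1.
  have -> : phi x = N (pad d (S^t*^t* *m rdiag x *m S^t*)).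
    by rewrite (uin_pad_conj _ (unitary_adj hS)).
  congr (N (pad d _)); rewrite trmxCK tr_perm_mx map_perm_mx.
  rewrite -row_permE -[s^-1%g]invgK -col_permE invgK.
  apply/matrixP=> i j; rewrite rdiagE [RHS]mxE [RHS]mxE rdiagE (inj_eq perm_inj).
  by rewrite [col_perm _ _ _ _]mxE.
have [s us] : exists s : 'S_k, forall i j : 'I_k, (i <= j)%N -> u 0 (s j) <= u 0 (s i).
  have /tuple_permP[s es] :
      perm_eq (sort >=%R [tuple u 0 i | i < k]) [tuple u 0 i | i < k].
    by rewrite perm_sort.
  exists s => i j ij.
  have es' (l : 'I_k) : (sort >=%R [tuple u 0 i | i < k])`_l = u 0 (s l).
    by rewrite es (nth_map l) -?enumT ?size_enum_ord// nth_ord_enum tnth_mktuple.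
  rewrite -!es'; apply: (@sorted_leq_nth _ (>=%R)) => //.
  - by move=> b a c /[swap]; apply: le_trans.
  - by move=> a; exact: lexx.
  - by apply: sort_sorted => a b; exact: le_total.
  - by rewrite inE size_sort size_tuple.
  - by rewrite inE size_sort size_tuple.
rewrite -(phi_sym s); apply: majorization_le => //.
- by move=> i j ij; rewrite mxE [leRHS]mxE us.
(* [I] collects the positions of the [m] largest entries of [u]. *)
- move=> m mk; pose I := s @: [set i : 'I_k | (i < m)%N].
  have cI : #|I| = m.
    by rewrite card_imset; [rewrite cardsE card_ord_lt|exact: perm_inj].
  have := lidskii I hH hL; rewrite cI; apply: le_trans.
  rewrite big_imset /=; last by move=> i j _ _; exact: perm_inj.
  rewrite [leRHS](eq_bigl (fun i : 'I_k => (i < m)%N)) => [|i]; last by rewrite inE.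
  apply: ler_sum => i _; rewrite [leLHS]mxE [leLHS]mxE [(- lambda _) _ _]mxE.
  by [].
(* Both totals equal [\tr L - \tr H]. *)
- rewrite (eq_bigr (fun i => u 0 (s i))) => [|i _]; last by rewrite mxE.
  rewrite -(reindex_inj (@perm_inj _ s) (P := xpredT) (F := fun i => u 0 i)) /=.
  apply: complexI; rewrite -(mxtrace_lambda hG) raddfB /=.
  rewrite (mxtrace_lambda hH) (mxtrace_lambda hL) -rmorphB -sumrB /=.
  by congr _%:C; apply: eq_bigr => i _; rewrite [LHS]mxE [(- lambda _) _ _]mxE.
Qed.
End Mirsky.

(** * Angles and residuals *)

(** Recentring at the midpoint of [[a, b]] turns the separation property into a gap of [delta]
    between absolute values. *)
Lemma midpoint_in (F : realFieldType) (a b x : F) :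
  a <= x <= b -> `|x - (a + b) / 2| <= (b - a) / 2.
Proof. by move=> /andP[h1 h2]; rewrite ler_norml; apply/andP; split; lra. Qed.

Lemma midpoint_out (F : realFieldType) (a b e x : F) :
  x <= a - e \/ b + e <= x -> (b - a) / 2 + e <= `|x - (a + b) / 2|.
Proof. by move=> h; rewrite ler_normr; apply/orP; case: h => h; [right|left]; lra. Qed.

Section Angles.
Variable R : realType.
Local Notation C := R[i].

Lemma rho_herm d k (A : 'M[C]_d) (X : 'M[C]_(d, k)) : A \is hermsymmx ->
  rho A X \is hermsymmx.
Proof. by move=> /hermP hA; apply/hermP; rewrite !trmxCM trmxCK hA mulmxA. Qed.

Lemma rho_mul d k (A : 'M[C]_d) (X : 'M[C]_(d, k)) (U : 'M[C]_k) :
  rho A (X *m U) = U^t* *m rho A X *m U.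
Proof. by rewrite /rho trmxCM !mulmxA. Qed.

Lemma isometry_size d k (X : 'M[C]_(d, k)) : X^t* *m X = 1%:M -> (k <= d)%N.
Proof.
move=> /(congr1 mxrank); rewrite mxrank1 => <-.
by rewrite (leq_trans (mxrankM_maxr _ _))// rank_leq_row.
Qed.

Lemma sqn_conj_rdiag n (V : 'M[C]_n) (x : 'rV[R]_n) v : V \is unitarymx ->
  sqn (V^t* *m rdiag x *m V *m v) =
  \sum_j x 0 j ^+ 2 *
    (complex.Re ((V *m v) j 0) ^+ 2 + complex.Im ((V *m v) j 0) ^+ 2).
Proof.
move=> hV; rewrite -!mulmxA (sqn_isom _ (unitaryC (unitary_adj hV))) sqn_coef.
apply: eq_bigr => j _; rewrite mul_diag_mx !mxE.
by case: (\sum_ _ _) => p q /=; rewrite !mul0r subr0 addr0; ring.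
Qed.

Lemma herm_shift_diag n (A : 'M[C]_n) (c : R) : A \is hermsymmx ->
  exists2 V, V \is unitarymx &
    A - (c%:C)%:M = V^t* *m rdiag (lambda A - const_mx c) *m V.
Proof.
move=> hA; have [V hV e] := herm_diagonalize hA; exists V; first exact: hV.
rewrite rdiagB rdiag_const mulmxBr mulmxBl -e mul_mx_scalar -scalemxAl.
by rewrite (unitaryC hV) scalemx1.
Qed.

Lemma herm_shift_opnorm_le n (A : 'M[C]_n) (c r : R) : A \is hermsymmx -> 0 <= r ->
  (forall i, `|lambda A 0 i - c| <= r) -> opnorm_le r (A - (c%:C)%:M).
Proof.
move=> hA r0 h; have [V hV ->] := herm_shift_diag c hA.
apply: opnorm_le_herm => // i; rewrite mxE [(- const_mx _) _ _]mxE [const_mx _ _ _]mxE.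
by rewrite -real_normK ?num_real// lerXn2r ?nnegrE.
Qed.

Lemma herm_shift_ge n (A : 'M[C]_n) (c r : R) v : A \is hermsymmx -> 0 <= r ->
  (forall i, r <= `|lambda A 0 i - c|) ->
  r ^+ 2 * sqn v <= sqn ((A - (c%:C)%:M) *m v).
Proof.
move=> hA r0 h; have [V hV ->] := herm_shift_diag c hA.
rewrite sqn_conj_rdiag// -(sqn_isom v (unitaryC hV)) sqn_coef mulr_sumr ler_sum// => i _.
rewrite ler_wpM2r ?addr_ge0 ?sqr_ge0//.
rewrite mxE [(- const_mx _) _ _]mxE [const_mx _ _ _]mxE.
by rewrite -[leRHS]real_normK ?num_real// lerXn2r ?nnegrE.
Qed.

(** [c] is the root of the last eigenvalue of [M^t* *m M] and [v] its eigenvector; a successor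
    number of columns guarantees that [ord_max] exists. *)
Lemma least_singular n m (M : 'M[C]_(m, n.+1)) :
  exists c v, [/\ 0 <= c, sqn v = 1, M^t* *m M *m v = (c ^+ 2)%:C *: v &
    forall u, c ^+ 2 * sqn u <= sqn (M *m u)].
Proof.
have hB : M^t* *m M \is hermsymmx by apply/hermP; rewrite trmxCM trmxCK.
have [V hV] := herm_diagonalize hB; set mu := lambda _ => e.
pose v := V^t* *m (delta_mx ord_max 0 : 'cV[C]_n.+1).
have v1 : sqn v = 1.
  rewrite sqn_isom ?trmxCK; last exact/unitarymxP.
  rewrite sqn_coef (bigD1 ord_max)//= big1 ?addr0 => [|i /negPf hi].
    by rewrite !mxE !eqxx /= expr1n expr0n addr0.
  by rewrite !mxE hi /= expr0n addr0.
have Bv : M^t* *m M *m v = (mu 0 ord_max)%:C *: v.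
  rewrite e /v -!mulmxA (mulmxA V) (unitarymxP hV) mul1mx rdiag_delta.
  by rewrite -scalemxAr.
have sB u : sqn (M *m u) = rdot u (M^t* *m M *m u).
  by rewrite /sqn /rdot trmxCM !mulmxA.
have mu0 : 0 <= mu 0 ord_max.
  by have := sqn_ge0 (M *m v); rewrite sB Bv rdotZr rdotE v1 mulr1.
exists (Num.sqrt (mu 0 ord_max)), v; rewrite sqr_sqrtr//; split=> //.
  exact: sqrtr_ge0.
move=> u; rewrite sB e rdot_conj rdot_rdiag -(sqn_isom u (unitaryC hV)).
rewrite sqn_coef mulr_sumr ler_sum// => i _.
rewrite ler_wpM2r ?addr_ge0 ?sqr_ge0//.
by apply: lambda_nonincreasing; rewrite -ltnS.
Qed.

Lemma subrB_telescope (V : zmodType) (x y z : V) : x - y = z - y - (z - x).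
Proof. by rewrite opprB [RHS]addrC addrA subrK. Qed.

Lemma trmxC_sylvester n (L P H : 'M[C]_n) : L^t* = L -> P^t* = P -> H^t* = H ->
  (L *m P - P *m H)^t* = P *m L - H *m P.
Proof. by move=> hL hP hH; rewrite trmxCB !trmxCM hL hP hH. Qed.

Lemma sylvester_sum n (L P H : 'M[C]_n) :
  P *m (L - H) + (L - H) *m P = (L *m P - P *m H) + (P *m L - H *m P).
Proof.
rewrite mulmxBr mulmxBl addrC addrACA [RHS]addrACA; congr (_ + _).
exact: addrC.
Qed.

Lemma lyapunov_split n (P G : 'M[C]_n) :
  (1%:M - P) *m G + G *m (1%:M - P) + (P *m G + G *m P) = 2%:C *: G.
Proof.
rewrite mulmxBl mulmxBr mul1mx mulmx1 [X in X + _]addrACA -opprD subrK.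
by rewrite rmorph_nat scaler_nat.
Qed.

Lemma oppr_scale n (v : 'cV[C]_n) : - v = (-1)%:C *: v.
Proof. by rewrite rmorphN1 scaleN1r. Qed.

(** Pythagoras for the projection onto the column space of [Y]. *)
Lemma sqn_compl n k (Y : 'M[C]_(n, k)) z : Y^t* *m Y = 1%:M ->
  sqn (z - Y *m (Y^t* *m z)) = sqn z - sqn (Y^t* *m z).
Proof.
move=> hY; rewrite oppr_scale sqnD rdotZr sqnZr rdot_adj rdotE (sqn_isom _ hY).
by rewrite sqrrN expr1n; ring.
Qed.

(** * The residual bound for fixed orthonormal bases *)

Section Residual.
Variables (d k p : nat) (A : 'M[C]_d) (X Y : 'M[C]_(d, k.+1)) (Xp : 'M[C]_(d, p)).
Variables (R' : 'M[C]_(d, k.+1)) (a b delta : R).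
Hypothesis hA : A \is hermsymmx.
Hypothesis hX : X^t* *m X = 1%:M.
Hypothesis hY : Y^t* *m Y = 1%:M.
Hypothesis hXp : Xp^t* *m Xp = 1%:M.
Hypothesis hXXp : X *m X^t* + Xp *m Xp^t* = 1%:M.
Hypothesis AX : A *m X = X *m rho A X.
Hypothesis XR : X^t* *m R' = X^t* *m (A *m Y - Y *m rho A Y).
Hypothesis YR : Y^t* *m R' = 0.
Hypothesis ab : a <= b.
Hypothesis delta0 : 0 < delta.
Hypothesis hin : forall i, a <= lambda (rho A Xp) 0 i <= b.
Hypothesis hout : forall i, lambda (rho A Y) 0 i <= a - delta \/
                            b + delta <= lambda (rho A Y) 0 i.
Variable N : 'M[C]_d -> R.
Hypothesis hN : unitarily_invariant_norm N.
Hypothesis hN1 : normalized N.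

Let r := N (pad d R').
Let kd : (k.+1 <= d)%N := isometry_size hX.
Let H := rho A Y.

(** Padding only puts an isometry in front of [R'^t*], and [N] dominates the operator norm by
    [sqn_le_uin]. *)
Lemma sqn_residual (w : 'cV[C]_d) : sqn (R'^t* *m w) <= sqn w * r ^+ 2.
Proof.
have e : (pad d R')^t* *m w = pid_mx k.+1 *m (R'^t* *m w).
  rewrite padE pid_mx_1 mul1mx trmxCM trmxCK mulmxA; congr (_ *m _).
have := sqn_le_uin hN (pad d R') w hN1; rewrite e.
by rewrite sqn_isom// pid_isom.
Qed.

(* The operator norm case of the tan Theta theorem: [c] and [s] are the cosine
   and the sine of the largest angle between the column spaces of [X] and [Y]. *)
Lemma largest_angle : exists c s : R, [/\ 0 <= c, 0 <= s, c ^+ 2 + s ^+ 2 = 1,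
  delta * s <= c * r & forall u, c ^+ 2 * sqn u <= sqn (X^t* *m Y *m u)].
Proof.
have [c [v [c0 v1 Cv hc]]] := least_singular (X^t* *m Y).
set C0 := X^t* *m Y in Cv hc.
have CC0 : C0^t* *m C0 = Y^t* *m (X *m X^t*) *m Y.
  by rewrite trmxCM trmxCK !mulmxA.
(* The part of [Y] orthogonal to [X]; its operator norm is the sine [s]. *)
pose T := Y - X *m C0.
have YT : Y^t* *m T = 1%:M - C0^t* *m C0.
  by rewrite mulmxBr hY CC0 !mulmxA.
have XT : X^t* *m T = 0 by rewrite mulmxBr mulmxA hX mul1mx subrr.
have sT u : sqn (T *m u) = sqn u - sqn (C0 *m u).
  rewrite -[sqn u](sqn_isom u hY) -mulmxA -sqn_compl// /T /C0 mulmxBl.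
  by rewrite !mulmxA.
have c1 : c ^+ 2 <= 1.
  have := sqn_ge0 (T *m v); rewrite sT subr_ge0 v1 => /(le_trans (hc v)).
  by rewrite v1 mulr1.
pose s := Num.sqrt (1 - c ^+ 2).
have s0 : 0 <= s by exact: sqrtr_ge0.
have s2 : s ^+ 2 = 1 - c ^+ 2 by rewrite sqr_sqrtr// subr_ge0.
have oT : opnorm_le s T.
  by move=> u; rewrite sT s2 mulrBl mul1r lerD2l lerN2.
pose z := T *m v.
have Yz : Y^t* *m z = (s ^+ 2)%:C *: v.
  by rewrite mulmxA YT mulmxBl mul1mx Cv s2 rmorphB scalerBl scale1r.
have sz : sqn z = s ^+ 2.
  rewrite /z sT v1 s2; congr (_ - _).
  rewrite -rdotE rdot_adj mulmxA Cv rdotZl rdotE v1 mulr1.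
  by [].
(* As [R'] is orthogonal to [Y], only this part of [z] meets it. Its norm is [s * c], the source of
   the factor [c] in the bound. *)
pose w := z - Y *m (Y^t* *m z).
have sw : sqn w = s ^+ 2 * c ^+ 2.
  by rewrite /w sqn_compl// Yz sqnZr v1 sz s2; ring.
pose m := (a + b) / 2; pose beta := (b - a) / 2.
have beta0 : 0 <= beta by rewrite divr_ge0// subr_ge0.
pose A' := A - (m%:C)%:M.
have AC : A^t* = A by apply/hermP.
have HC : H^t* = H by apply/hermP/rho_herm.
have R'Y : R'^t* *m Y = 0 by rewrite -[Y]trmxCK -trmxCM YR linear0 map_mx0.
have R'X : R'^t* *m X = (Y^t* *m A - H *m Y^t*) *m X.
  rewrite -[X in LHS]trmxCK -trmxCM XR trmxCM trmxCK; congr (_ *m _).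
  by rewrite -/H trmxCB (trmxCM A) (trmxCM Y) AC HC.
(* The columns of [T] are combinations of those of [X] and [Y], against which [R'] and the residual
   have the same products. *)
have R'T : R'^t* *m T = (Y^t* *m A - H *m Y^t*) *m T.
  rewrite /T 2!mulmxBr R'Y mulmxA R'X !mulmxA; congr (_ - _).
  by rewrite mulmxBl -[H *m _ *m _]mulmxA hY mulmx1 subrr.
have R'w : R'^t* *m w = (Y^t* *m A - H *m Y^t*) *m z.
  by rewrite mulmxBr (mulmxA _ Y) R'Y mul0mx subr0 /z mulmxA R'T -mulmxA.
(* The Sylvester equation at [z], recentred at [m], using that [Y^t* *m z] is [s ^+ 2] times [v]. *)
have eH : (s ^+ 2)%:C *: ((H - (m%:C)%:M) *m v) = Y^t* *m (A' *m z) - R'^t* *m w.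
  rewrite R'w scalemxAr -Yz mulmxBl [in RHS]mulmxBl mul_scalar_mx.
  rewrite mul_scalar_mx mulmxBr -scalemxAr mulmxBl -!mulmxA.
  exact: subrB_telescope.
have b1 : sqn (R'^t* *m w) <= (s * c * r) ^+ 2.
  by rewrite !exprMn -sw sqn_residual.
have Xz : X^t* *m z = 0 by rewrite mulmxA XT mul0mx.
have compl (q : 'cV_d) : X^t* *m q = 0 -> q = Xp *m (Xp^t* *m q).
  by move=> Xq; rewrite -[LHS]mul1mx -hXXp mulmxDl -mulmxA Xq mulmx0 add0r mulmxA.
(* Invariance of the span of [X] under the self-adjoint [A] passes to the orthogonal complement,
   where [A'] acts as the recentred [rho A Xp]. *)
have Xq : X^t* *m (A' *m z) = 0.
  rewrite /A' mulmxBl mul_scalar_mx mulmxBr -scalemxAr Xz scaler0 subr0 mulmxA.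
  rewrite -[A]AC -trmxCM AX trmxCM -mulmxA Xz mulmx0.
  by [].
have b2 : sqn (A' *m z) <= (beta * s) ^+ 2.
  have zt := compl _ Xz; set t := Xp^t* *m z in zt.
  have -> : A' *m z = Xp *m ((rho A Xp - (m%:C)%:M) *m t).
    rewrite [LHS](compl _ Xq); congr (Xp *m _); rewrite zt.
    rewrite /A' !mulmxBl mulmxBr !mul_scalar_mx -scalemxAr (mulmxA (Xp^t*) Xp) hXp mul1mx.
    by rewrite /rho !mulmxA.
  rewrite sqn_isom//.
  apply: le_trans (herm_shift_opnorm_le (c := m) (rho_herm Xp hA) beta0 _ _) _.
    by move=> i; exact: midpoint_in (hin i).
  have st : sqn z = sqn t by rewrite [in LHS]zt (sqn_isom t hXp).
  by rewrite -st sz [leRHS]exprMn.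
(* Replacing [Y^t*] by [T^t*] gains a second factor [s]. *)
have b3 : sqn (Y^t* *m (A' *m z)) <= (beta * s * s) ^+ 2.
  have -> : Y^t* *m (A' *m z) = T^t* *m (A' *m z).
    by rewrite trmxCB (trmxCM X C0) [RHS]mulmxBl -(mulmxA (C0^t*)) Xq mulmx0 subr0.
  apply: le_trans (opnorm_le_adj s0 oT _) _.
  by rewrite [leRHS]exprMn mulrC ler_wpM2r ?sqr_ge0.
have b4 : (s ^+ 2 * (beta + delta)) ^+ 2 <= sqn ((s ^+ 2)%:C *: ((H - (m%:C)%:M) *m v)).
  rewrite sqnZr exprMn ler_wpM2l ?sqr_ge0// -[X in X <= _]mulr1 -v1.
  apply: herm_shift_ge (rho_herm Y hA) _ _; first by rewrite addr_ge0// ltW.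
  by move=> i; exact: midpoint_out (hout i).
have r0 : 0 <= r by exact: uin_ge0.
exists c, s; split=> //; first by rewrite s2 addrC subrK.
have [->|sn0] := eqVneq s 0; first by rewrite mulr0 mulr_ge0.
have {sn0}sp : 0 < s by rewrite lt_neqAle eq_sym sn0.
(* Comparing both bounds gives [s^2 (beta + delta) <= beta s^2 + s c r]; then [beta s^2] and one
   factor [s] cancel. *)
have := le_trans b4 (_ : _ <= (beta * s * s + s * c * r) ^+ 2).
rewrite {1}eH oppr_scale; have hb : sqn ((-1)%:C *: (R'^t* *m w)) <= (s * c * r) ^+ 2.
  by rewrite sqnZr sqrrN expr1n mul1r.
have bs0 : 0 <= beta * s * s by rewrite mulr_ge0 // mulr_ge0.
have sr0 : 0 <= s * c * r by rewrite mulr_ge0 // mulr_ge0.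
have bd0 : 0 <= s ^+ 2 * (beta + delta).
  by rewrite mulr_ge0 ?sqr_ge0 // addr_ge0 // ltW.
move=> /(_ (sqn_triangle bs0 sr0 b3 hb)).
rewrite (ler_pXn2r _ bd0 (addr_ge0 bs0 sr0)) // -[delta * s <= _](ler_pM2l sp).
have -> : s ^+ 2 * (beta + delta) = beta * s * s + s * (delta * s) by ring.
by rewrite lerD2l -(mulrA s).
Qed.

Lemma residual_bound :
  N (pad_vec d (lambda (rho A X) - lambda (rho A Y))) <= r ^+ 2 / delta.
Proof.
have [c [s [c0 s0 cs ds hc]]] := largest_angle.
set C0 := X^t* *m Y in hc.
have r0 : 0 <= r by exact: uin_ge0.
(* If [c = 0] then [s = 1], and [delta * s <= c * r] would force [delta <= 0]. *)
have cp : 0 < c.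
  rewrite lt_neqAle c0 andbT eq_sym; apply: contraTneq ds => c00.
  move: cs; rewrite c00 expr0n add0r mul0r -ltNge => /eqP.
  by rewrite sqrp_eq1// => /eqP ->; rewrite mulr1.
have hC0 : C0 \in unitmx.
  rewrite -unitmx_tr -row_free_unit -kermx_eq0; apply/eqP/row_matrixP => i.
  rewrite row0; set u := row i _; have uC : C0 *m u^T = 0.
    rewrite -[C0]trmxK -trmx_mul; suff -> : u *m C0^T = 0 by rewrite trmx0.
    by apply/sub_kermxP; exact: row_sub.
  have := hc u^T; rewrite uC sqn0 pmulr_rle0 ?exprn_gt0// => h.
  apply: trmx_inj; rewrite trmx0; apply: sqn_eq0; apply/eqP.
  by rewrite eq_le h sqn_ge0.
have [U [V [q [hU hV q0 eC]]]] := polar hC0.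
set P := V^t* *m rdiag q *m V in eC.
have PC : P^t* = P by apply/hermP/rdiag_herm.
have sP u : sqn (P *m u) = sqn (C0 *m u).
  by rewrite eC -[U *m P *m u]mulmxA (sqn_isom _ (unitaryC hU)).
have sqC0 u : sqn (C0 *m u) <= sqn u.
  rewrite -[leRHS](sqn_isom u hY) -subr_ge0 -mulmxA -sqn_compl//.
  exact: sqn_ge0.
(* Test the two bounds on [C0] at the unit eigenvector of [P] for [q 0 i]. *)
have qb i : c <= q 0 i <= 1.
  have := hc (V^t* *m delta_mx i 0); have := sqC0 (V^t* *m delta_mx i 0).
  rewrite -sP /P -!mulmxA (mulmxA V) (unitarymxP hV) mul1mx rdiag_delta.
  rewrite -scalemxAr sqnZr; have -> : sqn (V^t* *m delta_mx i 0) = 1.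
    rewrite (sqn_isom _ (unitaryC (unitary_adj hV))).
    by apply: complexI; rewrite -sqnE trmx_delta map_delta_mx mul_delta_mx mxE !eqxx.
  rewrite !mulr1 => h1 h2; apply/andP; split.
    by rewrite -(@ler_pXn2r _ 2)// ?nnegrE// ltW.
  by rewrite -(@ler_pXn2r _ 2)// ?nnegrE ?expr1n// ltW.
have o1P : opnorm_le (1 - c) (1%:M - P).
  have -> : 1%:M - P = V^t* *m rdiag (const_mx 1 - q) *m V.
    by rewrite rdiagB rdiag_const mulmxBr mulmxBl mulmx1 (unitaryC hV).
  apply: opnorm_le_herm => // i; rewrite mxE [const_mx _ _ _]mxE [(- q) _ _]mxE.
  by have /andP[h1 h2] := qb i; rewrite lerXn2r ?nnegrE; lra.
have c1 : c <= 1 by have /andP[h1 h2] := qb ord0; exact: le_trans h1 h2.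
(* Rotating the basis by the polar factor makes [X'^t* *m Y] equal to the positive [P]; [M] is then
   the part of [X'] orthogonal to [Y]. *)
pose X' := X *m U; pose M := X' - Y *m P.
have X'Y : X'^t* *m Y = P.
  by rewrite trmxCM -mulmxA -/C0 eC mulmxA (unitaryC hU) mul1mx.
have YX' : Y^t* *m X' = P by rewrite -[RHS]PC -X'Y trmxCM trmxCK.
have X'X' : X'^t* *m X' = 1%:M.
  by rewrite trmxCM -mulmxA (mulmxA _ X) hX mul1mx (unitaryC hU).
have oM : opnorm_le s M.
  move=> u; have -> : M *m u = X' *m u - Y *m (Y^t* *m (X' *m u)).
    by rewrite (mulmxA (Y^t*)) YX' mulmxA -mulmxBl.
  rewrite sqn_compl// (sqn_isom _ X'X') mulmxA YX' sP.
  have -> : s ^+ 2 = 1 - c ^+ 2 by rewrite -cs [RHS]addrC addKr.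
  by rewrite mulrBl mul1r lerD2l lerN2 hc.
pose G := rho A X' - H.
have AX' : A *m X' = X' *m rho A X'.
  rewrite /X' rho_mul !mulmxA AX -[in RHS](mulmxA X) (unitarymxP hU) mulmx1.
  by rewrite /rho !mulmxA.
have L'C : (rho A X')^t* = rho A X' by apply/hermP/rho_herm.
have HC : H^t* = H by apply/hermP/rho_herm.
(* The [Y] part of [M] is killed by [R'], and invariance moves [A] across [X'^t*]. *)
have MR : M^t* *m R' = rho A X' *m P - P *m H.
  rewrite trmxCB (trmxCM Y) mulmxBl -[_ *m R' in X in _ - X]mulmxA YR mulmx0 subr0.
  rewrite trmxCM -mulmxA XR mulmxA -trmxCM -/X' -/H.
  have X'A : X'^t* *m A = rho A X' *m X'^t*.
    by rewrite -{1}((hermP A).1 hA) -trmxCM AX' trmxCM L'C.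
  by rewrite mulmxBr (mulmxA _ A) X'A (mulmxA _ Y) X'Y -(mulmxA _ _ Y) X'Y.
have RM : R'^t* *m M = P *m rho A X' - H *m P.
  by rewrite -[LHS]trmxCK [(R'^t* *m M)^t*]trmxCM trmxCK MR; exact: trmxC_sylvester.
have GP : P *m G + G *m P = M^t* *m R' + R'^t* *m M.
  by rewrite MR RM; exact: sylvester_sum.
have bound : c * N (pad d G) <= s * r.
  (* [1 - P] has norm at most [1 - c], so [P G + G P] has norm at least [2 c N(G)]. *)
  have e2 : 2%:C *: G = (1%:M - P) *m G + G *m (1%:M - P) + (M^t* *m R' + R'^t* *m M).
    by rewrite -GP lyapunov_split.
  have : 2 * N (pad d G) <= (1 - c) * N (pad d G) *+ 2 + (s * r) *+ 2.
    rewrite -(uinZr hN)// -padZ e2 padD.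
    apply: le_trans (uin_triangle hN _ _) _; apply: lerD.
      rewrite padD; apply: le_trans (uin_triangle hN _ _) _.
      rewrite (padM _ _ kd) (padM _ _ kd) mulr2n; apply: lerD.
        by apply: uin_mull_le => //; [lra|exact: opnorm_le_pad].
      by apply: uin_mulr_le => //; [lra|exact: opnorm_le_pad].
    rewrite padD; apply: le_trans (uin_triangle hN _ _) _.
    have h : N (pad d (M^t* *m R')) <= s * r.
      by rewrite padM//; apply: uin_mull_le => //; apply: opnorm_le_pad => //; exact: opnorm_le_adj.
    rewrite mulr2n; apply: (lerD h); rewrite -(uin_adj hN) -pad_adj trmxCM trmxCK.
    exact: h.
  by rewrite !mulr2n; lra.
(* [rho A X] and [rho A X'] are unitarily conjugate, so their spectra agree. *)
have : N (pad_vec d (lambda (rho A X) - lambda H)) <= N (pad d G).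
  rewrite -(lambda_conj (rho_herm X hA) hU) -rho_mul.
  exact (mirsky hN kd (rho_herm Y hA) (rho_herm X' hA)).
move/le_trans; apply; rewrite ler_pdivlMr//.
(* Multiplied by [c > 0], the goal follows from [c N(G) <= s r] and [delta s <= c r]. *)
rewrite -(ler_pM2l cp) mulrA.
apply: le_trans (ler_wpM2r (ltW delta0) bound) _.
rewrite mulrAC (mulrC s) expr2 mulrA ler_wpM2r//.
Qed.

End Residual.
End Angles.

(** * Orthonormal bases of subspaces *)

Section Bases.
Variables (R : realType) (d k : nat).
Local Notation C := R[i].
Implicit Types (Z : {vspace 'cV[C]_d}) (M : 'M[C]_(d, k)).

Lemma onb_mulmx_mem Z M (u : 'cV[C]_k) : has_orthonormal_basis Z M -> M *m u \in Z.
Proof.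
move=> [_ /span_basis <-].
have -> : M *m u = \sum_j u j 0 *: col j M.
  apply/matrixP=> i j; rewrite ord1 mxE summxE; apply: eq_bigr => l _.
  by rewrite !mxE mulrC.
apply: memv_suml => j _; apply: memvZ; apply: memv_span; apply/imageP; by exists j.
Qed.

Lemma onb_mulmxK Z M v : has_orthonormal_basis Z M -> v \in Z ->
  M *m (M^t* *m v) = v.
Proof.
move=> hM vZ; have [MM /span_basis sM] := hM.
have [u ->] : exists u : 'cV[C]_k, v = M *m u.
  rewrite -sM in vZ.
  pose b := [tuple col j M | j < k].
  have eb : [seq col j M | j : 'I_k] = b by [].
  rewrite eb in vZ; exists (\col_j coord b j v).
  rewrite {1}(coord_span vZ); apply/matrixP=> i j; rewrite ord1 mxE summxE.
  apply: eq_bigr => l _; rewrite !mxE mulrC; congr (_ * _).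
  by rewrite -tnth_nth tnth_mktuple mxE.
by rewrite (mulmxA (M^t*)) MM mul1mx.
Qed.

Lemma adj_mulmx_eq0 M (v : 'cV[C]_d) :
  (forall u : 'cV_k, (M *m u)^t* *m v = 0) -> M^t* *m v = 0.
Proof.
move=> h; apply/row_matrixP => i; rewrite row0 rowE.
have := h (delta_mx i 0); rewrite trmxCM -mulmxA trmx_delta map_delta_mx.
by [].
Qed.

Lemma ortho_onbP Z M v : has_orthonormal_basis Z M ->
  v \in ortho_vs Z <-> M^t* *m v = 0.
Proof.
move=> hM; rewrite ortho_vsP; split=> [h|h u uZ].
  by apply: adj_mulmx_eq0 => u; exact: h (onb_mulmx_mem u hM).
by rewrite -(onb_mulmxK hM uZ) trmxCM -mulmxA h mulmx0.
Qed.

Lemma eq_mulmx_col m n (A B : 'M[C]_(m, n)) :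
  (forall v : 'cV[C]_n, A *m v = B *m v) -> A = B.
Proof.
move=> h; apply/matrixP=> i j; have := h (delta_mx j 0).
by rewrite -!colE => /matrixP/(_ i 0); rewrite !mxE.
Qed.

(** What the projection discards is orthogonal to [Z], hence killed by [M^t*]. Applied with [X] and
    with [Y], this transfers products with the residual to the projected residual. *)
Lemma orthproj_onb Z (M : 'M[C]_(d, k)) n (B : 'M[C]_(d, n)) :
  (forall u, M *m u \in Z) -> M^t* *m (orthproj Z *m B) = M^t* *m B.
Proof.
move=> hM; apply: eq_mulmx_col => v; rewrite -!mulmxA.
have [_ /ortho_vsP h] := orthprojP Z (B *m v).
apply/eqP; rewrite eq_sym -subr_eq0 -mulmxBr; apply/eqP.
by apply: adj_mulmx_eq0 => u; exact: h.
Qed.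

End Bases.

Theorem theorem3p23 (R : realType) (d k : nat) (A : 'M[R[i]]_d)
    (XX YY : {vspace 'cV[R[i]]_d}) (delta : R) (X Y : 'M[R[i]]_(d, k))
    (hA : A \is hermsymmx) (hXX : \dim XX = k) (hYY : \dim YY = k)
    (hdelta : 0 < delta) (hDKN : DKN k A XX YY delta)
    (hX : has_orthonormal_basis XX X) (hY : has_orthonormal_basis YY Y)
    (N : 'M[R[i]]_d -> R)
    (hN : unitarily_invariant_norm N) (hN1 : normalized N) :
  let R_Y := A *m Y - Y *m rho A Y in
  N (pad_vec d (lambda (rho A X) - lambda (rho A Y)))
    <= N (pad d (orthproj (XX + YY)%VS *m R_Y)) ^+ 2 / delta.
Proof.
cbv zeta; set R_Y := A *m Y - _; set R' := orthproj _ *m R_Y.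
(* With no columns the left side is the norm of zero; otherwise a least singular value exists. *)
destruct k as [|k'].
  rewrite /pad_vec /pad [diag_mx _]flatmx0 mulmx0 mul0mx (uin0 hN).
  by rewrite divr_ge0 ?sqr_ge0// ltW.
have [_ _ _ inv [Xp [Y1 [hXp hY1 [a [b [ab hin hout]]]]]]] := hDKN.
have [XtX _] := hX; have [YtY _] := hY; have [XpXp _] := hXp; have [Y1tY1 _] := hY1.
(* The basis [Y1] supplied by the separation property differs from [Y] by the unitary
   [Y1^t* *m Y]. *)
have lamY : lambda (rho A Y) = lambda (rho A Y1).
  have eY : Y = Y1 *m (Y1^t* *m Y).
    by apply: eq_mulmx_col => v; rewrite -!mulmxA (onb_mulmxK hY1)// (onb_mulmx_mem _ hY).
  rewrite {1}eY rho_mul lambda_conj//; first exact: rho_herm.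
  by apply: unitaryP; rewrite trmxCM trmxCK -mulmxA -eY.
have XY (z : 'cV_d) : X^t* *m z = 0 -> Xp *m (Xp^t* *m z) = z.
  by move=> Xz; apply: (onb_mulmxK hXp); apply/(ortho_onbP _ hX).
have XtXp : X^t* *m Xp = 0.
  apply: eq_mulmx_col => v; rewrite mul0mx -mulmxA; apply/(ortho_onbP _ hX).
  exact: onb_mulmx_mem.
have XXp : X *m X^t* + Xp *m Xp^t* = 1%:M.
  apply: eq_mulmx_col => v; rewrite mul1mx mulmxDl.
  have Xpv : Xp^t* *m X = 0 by rewrite -[LHS]trmxCK trmxCM trmxCK XtXp linear0 map_mx0.
  (* The remainder is orthogonal to [X], so [Xp *m Xp^t*] reproduces it, while [Xp^t*] kills the
     subtracted part. *)
  have := XY (v - X *m (X^t* *m v)).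
  rewrite [X^t* *m (_ - _)]mulmxBr (mulmxA _ X) XtX mul1mx subrr => /(_ erefl).
  rewrite [Xp^t* *m (_ - _)]mulmxBr (mulmxA (Xp^t*) X) Xpv mul0mx subr0 => e.
  by rewrite -[X *m X^t* *m v]mulmxA -[Xp *m Xp^t* *m v]mulmxA e addrC subrK.
have AX : A *m X = X *m rho A X.
  apply: eq_mulmx_col => v; rewrite /rho -!mulmxA (onb_mulmxK hX)//.
  by apply: inv; exact: onb_mulmx_mem hX.
have XZ u : X *m u \in (XX + YY)%VS.
  by apply: (subvP (addvSl XX YY)); exact: onb_mulmx_mem hX.
have YZ u : Y *m u \in (XX + YY)%VS.
  by apply: (subvP (addvSr XX YY)); exact: onb_mulmx_mem hY.
have YR : Y^t* *m R' = 0.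
  by rewrite (orthproj_onb _ YZ) mulmxBr (mulmxA _ Y) YtY mul1mx /rho mulmxA subrr.
apply: (residual_bound hA XtX YtY XpXp XXp AX (orthproj_onb _ XZ) YR ab) => //.
by move=> i; rewrite lamY.
Qed.
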